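(* Under the setup in the context (fixed, undirected, connected graph): (i) If $\beta>\frac{1}{2f_M}\big(\frac{\gamma\lambda_G^2}{\lambda_2^3}+\gamma\alpha\big)$, then for all $i\in\{1,\dots,N\}$ and $j\in N_i$, $$\lim_{t\to\infty}E\big[(K_2x_i(t)-K_2\bar x(t))^2\big]=0,\qquad \lim_{t\to\infty}E\big[(\hat z_{ij}(t)-K_2x_j(t))^2\big]=0.$$ (ii) If $\gamma>\frac1{\lambda_2}$ and $\beta>\frac{1}{2f_M}\big(\frac{\gamma^2\lambda_G^2}{\lambda_2^2(\gamma\lambda_2-1)}+\gamma\alpha+1\big)$, then there is a constant $C>0$ such that for all $i$, all $j\in N_i$ and all $t\ge t_0+1$, $$E\big[(K_2x_i(t)-K_2\bar x(t))^2\big]\le\frac Ct,\qquad E\big[(\hat z_{ij}(t)-K_2x_j(t))^2\big]\le\frac Ct.$$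
   Context: Fix integers $n\ge 2$ and $N\ge 2$. Let $a_1,\dots,a_n\in\mathbb{R}$, let $A\in\mathbb{R}^{n\times n}$ be the matrix with $A_{k,k+1}=1$ for $k=1,\dots,n-1$, last row $(a_1,a_2,\dots,a_n)$, and all other entries $0$, and let $B=(0,\dots,0,1)^T\in\mathbb{R}^n$. There are $N$ agents with dynamics $x_i(t+1)=Ax_i(t)+Bu_i(t)$, $i=1,\dots,N$, where $x_i(t)=(x_{i1}(t),\dots,x_{in}(t))^T\in\mathbb{R}^n$ and $u_i(t)\in\mathbb{R}$; write $\bar x(t)=\frac1N\sum_{i=1}^N x_i(t)$. Communication graph: $G$ is a fixed, undirected, connected graph on $\{1,\dots,N\}$; $N_i$ is the neighbor set of agent $i$, $d_i=|N_i|$, $d_{\max}=\max_i d_i$, and $L$ is the Laplacian of $G$ (degree matrix minus adjacency matrix), with eigenvalues $0=\lambda_1<\lambda_2\le\dots\le\lambda_N$. Gains: real numbers $b_1,\dots,b_{n-1}$ (compression coefficients), $K_2=[b_1,\dots,b_{n-1},1]\in\mathbb R^{1\times n}$, and $K_1=[-a_1+b_1,\,-a_2+b_2-b_1,\,\dots,\,-a_{n-1}+b_{n-1}-b_{n-2},\,-a_n-b_{n-1}+1]\in\mathbb R^{1\times n}$. Communication: for every ordered pair $(i,j)$ with $j\in N_i$ and every integer $t$, agent $i$ receives the bit $s_{ij}(t)=1$ if $K_2x_j(t)+d_{ij}(t)\le c_{ij}$ and $s_{ij}(t)=0$ otherwise, where $c_{ij}\in\mathbb R$ are fixed thresholds and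 the noises $\{d_{ij}(t)\}$ are i.i.d. $N(0,\sigma^2)$, $\sigma>0$, over all $i,j,t$; $F$ and $f$ denote the distribution function and density of $N(0,\sigma^2)$. Algorithm: fix $\beta>0$, $\gamma>0$, an integer $t_0>\gamma d_{\max}-1$, deterministic initial states $x_i(t_0+1)=x_i^0$ and deterministic initial estimates $\hat z_{ij}(t_0)=\hat z_{ij}^0$, and $M>0$ with $|K_2x_i^0|\le M$ and $|\hat z^0_{ij}|\le M$ for all $i$ and $j\in N_i$. Let $\Pi_M(\zeta)=\max\{-M,\min\{M,\zeta\}\}$ (projection onto $[-M,M]$). For $t\ge t_0+1$, for all $i$ and $j\in N_i$: $\hat z_{ij}(t)=\Pi_M\big(\hat z_{ij}(t-1)+\tfrac{\beta}{t}(F(c_{ij}-\hat z_{ij}(t-1))-s_{ij}(t))\big)$, and $u_i(t)=K_1x_i(t)+\frac{\gamma}{t+1}\sum_{j\in N_i}(\hat z_{ij}(t)-K_2x_i(t))$. Constants: enumerate the $d=\sum_i d_i$ ordered pairs $(i,j)$ with $j\in N_i$ as $p=1,\dots,d$. Let $W\in\mathbb R^{N\times d}$ with $W_{k,p}=1$ if pair $p$ has first component $k$ and $0$ otherwise; $Q\in\mathbb R^{d\times N}$ with $Q_{p,k}=1$ if pair $p$ has second component $k$ and $0$ otherwise; $J_N=I_N-\frac1N\mathbf 1_N\mathbf 1_N^T$. With $\|\cdot\|$ the spectral norm, set $\lambda_G=\|J_NW\|^2$, $\lambda_{QW}=\|QW\|^2$, $\lambda_{QL}=\|QL\|^2$,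 $\alpha=2\sqrt{\lambda_{QW}}+\lambda_{QL}\lambda_2/\lambda_G$, and $f_M=\min_{(i,j):\,j\in N_i} f(|c_{ij}|+M)$. *)

(* Defs.v *)
From HB Require Import structures.
From mathcomp Require Import all_boot all_order all_algebra.
From mathcomp Require Import all_classical all_reals all_analysis.
Set Implicit Arguments. Unset Strict Implicit. Unset Printing Implicit Defensive.
Import Order.TTheory GRing.Theory Num.Theory.
Import numFieldNormedType.Exports.
Local Open Scope classical_set_scope.
Local Open Scope ring_scope.

Section Setup.
Variable R : realType.

(* A : companion matrix, A_{k,k+1} = 1 (k < n-1), last row (a_1..a_n) = (a 0 .. a (n-1)) *)
Definition Amat (n : nat) (a : 'I_n -> R) : 'M[R]_n :=
  \matrix_(i, j) (if (i.+1 == n)%N then a j else ((j : nat) == i.+1)%:R).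
Definition Bvec (n : nat) : 'cV[R]_n := \col_(i < n) ((i.+1 == n)%N)%:R.
(* K2 = [b_1, ..., b_{n-1}, 1]  with b_k = b (k-1) *)
Definition K2ent (n : nat) (b : nat -> R) (k : nat) : R :=
  if (k < n.-1)%N then b k else 1.
Definition K2mat (n : nat) (b : nat -> R) : 'rV[R]_n := \row_(j < n) K2ent n b j.
(* K1 = [-a_1+b_1, -a_2+b_2-b_1, ..., -a_{n-1}+b_{n-1}-b_{n-2}, -a_n-b_{n-1}+1] *)
Definition K1mat (n : nat) (a : 'I_n -> R) (b : nat -> R) : 'rV[R]_n :=
  \row_(j < n) (- a j + K2ent n b j - (if (j : nat) == 0%N then 0 else K2ent n b j.-1)).

Definition rdot (n : nat) (K : 'rV[R]_n) (x : 'cV[R]_n) : R := (K *m x) 0 0.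

Definition nbrs (N : nat) (adj : rel 'I_N) (i : 'I_N) : {set 'I_N} := [set j | adj i j].
Definition deg (N : nat) (adj : rel 'I_N) (i : 'I_N) : nat := #|nbrs adj i|.
Definition dmax (N : nat) (adj : rel 'I_N) : nat := \max_(i < N) deg adj i.
Definition laplacian (N : nat) (adj : rel 'I_N) : 'M[R]_N :=
  \matrix_(i, j) ((i == j)%:R * (deg adj i)%:R - (adj i j)%:R).
Definition edges (N : nat) (adj : rel 'I_N) : {set 'I_N * 'I_N} :=
  [set p | adj p.1 p.2].
Definition Wmat (N : nat) (adj : rel 'I_N) : 'M[R]_(N, #|edges adj|) :=
  \matrix_(k, p) (((enum_val p).1 == k)%:R).
Definition Qmat (N : nat) (adj : rel 'I_N) : 'M[R]_(#|edges adj|, N) :=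
  \matrix_(p, k) (((enum_val p).2 == k)%:R).
Definition Jmat (N : nat) : 'M[R]_N := 1%:M - (N%:R)^-1 *: const_mx 1.

Definition vnorm (m : nat) (v : 'cV[R]_m) : R := Num.sqrt (\sum_i v i 0 ^+ 2).
Definition specnorm (m k : nat) (Mx : 'M[R]_(m, k)) : R :=
  sup [set vnorm (Mx *m v) | v in [set v : 'cV[R]_k | vnorm v <= 1]].

Definition Fnorm (sigma : R) (x : R) : R :=
  fine (normal_prob 0 sigma [set y | y <= x]).
Definition fnorm (sigma : R) (x : R) : R := normal_pdf 0 sigma x.

(* f_M = min over pairs (i,j), j in N_i, of f(|c_ij| + M);
   the neutral element f(0) is the maximum of f, so it does not change the min
   over the (nonempty) edge set. *)
Definition fM (N : nat) (adj : rel 'I_N) (c : 'I_N -> 'I_N -> R) (sigma M : R) : R :=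
  \big[Num.min/fnorm sigma 0]_(p in edges adj) fnorm sigma (`|c p.1 p.2| + M).

Definition projM (M z : R) : R := Num.max (- M) (Num.min M z).

(* state k = (x(t0+1+k), zhat(t0+k)) *)
Fixpoint state (n N : nat) (A : 'M[R]_n) (B : 'cV[R]_n) (K1 K2 : 'rV[R]_n)
  (adj : rel 'I_N) (c : 'I_N -> 'I_N -> R) (F : R -> R) (beta gamma M : R)
  (t0 : nat) (x0 : 'I_N -> 'cV[R]_n) (z0 : 'I_N -> 'I_N -> R)
  (T : Type) (noise : 'I_N -> 'I_N -> nat -> T -> R) (w : T) (k : nat)
  : ('I_N -> 'cV[R]_n) * ('I_N -> 'I_N -> R) :=
  match k with
  | 0%N => (x0, z0)
  | k'.+1 =>
    let st := state A B K1 K2 adj c F beta gamma M t0 x0 z0 noise w k' in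
    let x := st.1 in let z := st.2 in
    let t := (t0 + 1 + k')%N in
    let s i j : R := if rdot K2 (x j) + noise i j t w <= c i j then 1 else 0 in
    let z' i j := projM M (z i j + beta / t%:R * (F (c i j - z i j) - s i j)) in
    let u i := rdot K1 (x i)
               + gamma / (t + 1)%:R * \sum_(j | adj i j) (z' i j - rdot K2 (x i)) in
    (fun i => A *m x i + u i *: B, z')
  end.

Definition mutually_independent (dT : measure_display) (T : measurableType dT)
  (P : probability T R) (I : eqType) (D : set I) (X : I -> T -> R) : Prop :=
  forall (s : seq I) (B : I -> set R), uniq s -> (forall i, i \in s -> D i) ->
    (forall i, measurable (B i)) ->
    fine (P (\big[setI/setT]_(i <- s) (X i @^-1` B i)))
    = \prod_(i <- s) fine (P (X i @^-1` B i)).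

End Setup.

(* Main.v *)
(* With y_i = K2 x_i the choice of K1 reduces the closed loop to
   y(t+1) = y(t) + gamma/(t+1) (- L delta(t) + W eps(t)), where delta = J_N y is
   the disagreement and eps = zhat - Q y the estimation error.  As the gains keep
   y and zhat in [-M, M], all second order terms are O(1/t^2).  The spectral gap
   of L contracts |delta|^2, and strong monotonicity of F on bounded sets (with
   constant f_M) contracts |eps|^2; the conditions on beta and gamma say exactly
   that the symmetric 2 x 2 matrix coupling the two rates has its spectrum below
   0 (resp. below -1), so some combination Z = w1 |delta|^2 + w2 |eps|^2 satisfies
   E Z(t+1) <= (1 - mu/(t+1)) E Z(t) + C/(t+1)^2 with mu > 0 (resp. mu > 1).
   The noise contributes nothing on average: the state at time t is a function of
   finitely many received bits, and fixing these bits restricts finitely many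
   past noises to deterministic sets, which are independent of the next noise. *)
Require Import Defs.
From HB Require Import structures.
From mathcomp Require Import all_boot all_order all_algebra.
From mathcomp Require Import all_classical all_reals all_analysis.
From mathcomp Require Import ring lra.
From mathcomp Require Import complex measurable_realfun.
Set Implicit Arguments. Unset Strict Implicit. Unset Printing Implicit Defensive.
Import Order.TTheory GRing.Theory Num.Theory.
Import numFieldNormedType.Exports.
Local Open Scope classical_set_scope.
Local Open Scope ring_scope.

(** * The spectral gap of the Laplacian *)

(** Both Young inequalities are balanced so that disagreement and estimation error feed each other
    at the same rate r = gamma lambda_G / lambda_2, while their own decay rates are gamma lambda_2
    and 2 beta f_M - gamma alpha. The bounds on beta are then exactly r^2 < (gamma lambda_2 -
    mu_0)(2 beta f_M - gamma alpha - mu_0), with mu_0 = 0 in (i) and mu_0 = 1 in (ii). The delicate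
    point is timing. The bit of time t+1 is a noisy reading of y_j(t+1), while the estimate that it
    corrects was aimed at y_j(t). So the error is first shifted by the move of y and only then
    contracted, and F at the old estimate is compared with F at the new y_j(t+1), around which the
    bit is centred. Conditional expectations are avoided: for each length there are finitely many
    histories, so every random quantity is a simple function and its integrability is automatic. *)

Lemma laplacian_form (K : comNzRingType) (N : nat) (adj : rel 'I_N)
    (u v : 'I_N -> K) : symmetric adj ->
  (\sum_i \sum_j u i * ((i == j)%:R * (deg adj i)%:R - (adj i j)%:R) * v j) *+ 2
  = \sum_i \sum_j (adj i j)%:R * ((u i - u j) * (v i - v j)).
Proof.
move=> adjC.
have degE i : (deg adj i)%:R = \sum_j (adj i j)%:R :> K.
  rewrite /deg -sum1_card natr_sum big_mkcond /=; apply: eq_bigr => j _.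
  by rewrite inE; case: (adj i j).
pose S f := \sum_i \sum_j (adj i j)%:R * f i j : K.
have SD f g : S (fun i j => f i j + g i j) = S f + S g.
  rewrite /S -big_split; apply: eq_bigr => i _; rewrite -big_split /=.
  by apply: eq_bigr => j _; rewrite mulrDr.
have SN f : S (fun i j => - f i j) = - S f.
  rewrite /S -sumrN; apply: eq_bigr => i _; rewrite -sumrN.
  by apply: eq_bigr => j _; rewrite mulrN.
have SC f : S (fun i j => f j i) = S f.
  rewrite /S exchange_big /=; apply: eq_bigr => i _; apply: eq_bigr => j _.
  by rewrite adjC.
transitivity (S (fun i j => u i * v i) *+ 2 - S (fun i j => u i * v j) *+ 2).
  rewrite -mulrnBl; congr (_ *+ 2); rewrite /S -sumrB; apply: eq_bigr => i _.
  transitivity (u i * (deg adj i)%:R * v i - \sum_j u i * (adj i j)%:R * v j).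
    rewrite (bigD1 i) //= eqxx mul1r.
    rewrite [X in _ = _ - X](bigD1 i) //= mulrBr mulrBl opprD addrA.
    congr (_ + _); rewrite -sumrN; apply: eq_bigr => j /negbTE.
    by rewrite eq_sym => ->; rewrite mul0r sub0r mulrN mulNr.
  rewrite degE mulr_sumr mulr_suml; congr (_ - _); apply: eq_bigr => j _; ring.
transitivity (S (fun i j => u i * v i) - S (fun i j => u i * v j)
   - (S (fun i j => u j * v i) - S (fun i j => u j * v j))).
  rewrite (SC (fun i j => u i * v j)) (SC (fun i j => u i * v i)); ring.
rewrite -!SN -!SD -!SN -!SD /S.
by apply: eq_bigr => i _; apply: eq_bigr => j _; ring.
Qed.

Lemma connect_constant (T : finType) (K : Type) (e : rel T) (r : T -> K) :
  (forall x y, e x y -> r x = r y) -> forall x y, connect e x y -> r x = r y.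
Proof.
move=> he x y /connectP[p hp ->] {y}.
by elim: p x hp => //= y p IH x /andP[/he -> /IH].
Qed.

(** A member with a strictly smaller one before it has index at least 1. With [x] the eigenvalue 0,
    every positive eigenvalue is at least the second entry of the sorted list. *)
Lemma sorted_nth1_le (R : realType) (s : seq R) (x y : R) :
  sorted <=%R s -> x \in s -> y \in s -> x < y -> s`_1 <= y.
Proof.
move=> ss xs ys xy.
have tr : transitive (<=%R : rel R) := le_trans.
have h : forall i j, (i < size s)%N -> (j < size s)%N -> (i <= j)%N ->
   s`_i <= s`_j.
  by move=> i j hi hj ij; apply: (sorted_leq_nth tr lexx 0 ss).
have hy := nth_index 0 ys; have iy : (index y s < size s)%N by rewrite index_mem.
have hx := nth_index 0 xs; have ix : (index x s < size s)%N by rewrite index_mem.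
case E : (index y s) => [|m].
  have := h (index y s) (index x s) iy ix; rewrite E => /(_ isT).
  by rewrite -[X in nth _ _ X]E hy hx leNgt xy.
by rewrite -hy E h // -?E //; apply: leq_ltn_trans iy; rewrite E.
Qed.

Section Fiedler.
Local Open Scope complex_scope.
Local Open Scope sesquilinear_scope.
Variables (R : realType) (N : nat) (adj : rel 'I_N).
Hypotheses (adjC : symmetric adj) (adj_conn : forall i j, connect adj i j).
Variable lam : seq R.
Hypothesis lam_sorted : sorted <=%R lam.
Hypothesis lam_char :
  char_poly (laplacian R adj) = \prod_(x <- lam) ('X - x%:P).

(** The spectral theorem is applied to Hermitian matrices over [R[i]], so the real symmetric
    Laplacian is embedded there. *)
Let C := R[i].
Let LC : 'M[C]_N := map_mx (real_complex R) (laplacian R adj).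
Let U := spectralmx LC.
Let d i := spectral_diag LC 0 i.

Let LCE i j : LC i j = (i == j)%:R * (deg adj i)%:R - (adj i j)%:R.
Proof. by rewrite !mxE rmorphB rmorphM /= !rmorph_nat. Qed.

Let LC_herm : LC \is hermsymmx.
Proof.
apply: realsym_hermsym.
  apply/is_hermitianmxP; rewrite expr0 scale1r map_mx_id //.
  apply/matrixP => i j; rewrite [RHS]mxE !LCE adjC eq_sym.
  by have [->|] := eqVneq; rewrite ?mul0r.
by apply/mxOverP => i j; rewrite LCE rpredB ?rpredM ?realn.
Qed.

Let LC_spec : LC = U^t* *m diag_mx (spectral_diag LC) *m U.
Proof.
have /orthomx_spectralP e := hermitian_normalmx LC_herm.
by rewrite {1}e invmx_unitary // spectral_unitarymx.
Qed.

Let U_unit : U *m U^t* = 1%:M.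
Proof. exact/unitarymxP/spectral_unitarymx. Qed.

(** [laplacian_form] is applied with the conjugate of [v] as second argument, hence its bilinear
    form over a commutative ring. The factor 2 counts each edge in both orders. *)
Let formE (u v : 'rV[C]_N) :
  (u *m LC *m v^t*) 0 0 *+ 2
  = \sum_i \sum_j (adj i j)%:R * ((u 0 i - u 0 j) * ((v 0 i)^* - (v 0 j)^*)).
Proof.
rewrite -laplacian_form //; congr (_ *+ 2); rewrite mxE exchange_big /=.
apply: eq_bigr => j _; rewrite mxE mulr_suml; apply: eq_bigr => i _.
by rewrite LCE !mxE.
Qed.

Let row_eig i : row i U *m LC = d i *: row i U.
Proof.
rewrite LC_spec -!row_mul !mulmxA U_unit mul1mx.
by apply/rowP => j; rewrite [LHS]mxE mul_diag_mx !mxE.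
Qed.

Let row_norm i j : (row i U *m (row j U)^t*) 0 0 = (i == j)%:R.
Proof.
have /matrixP/(_ i j) := U_unit; rewrite mxE [RHS]mxE => <-; rewrite mxE.
by apply: eq_bigr => k _; rewrite !mxE.
Qed.

Let d_form i : d i *+ 2
  = \sum_k \sum_j (adj k j)%:R * `|U i k - U i j| ^+ 2.
Proof.
transitivity ((row i U *m LC *m (row i U)^t*) 0 0 *+ 2).
  by rewrite row_eig -scalemxAl mxE row_norm eqxx mulr1.
rewrite formE; apply: eq_bigr => k _; apply: eq_bigr => j _.
by rewrite !mxE -rmorphB normCK.
Qed.

Let d_ge0 i : 0 <= d i.
Proof.
rewrite -(pmulrn_lge0 _ (ltn0Sn 1)) d_form; apply: sumr_ge0 => k _.
by apply: sumr_ge0 => j _; rewrite mulr_ge0 ?ler0n ?exprn_ge0.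
Qed.

(** By [d_form] a sum of nonnegative terms vanishes, so the eigenvector agrees across every edge,
    and by connectivity everywhere. *)
Let d_eq0 i : d i = 0 -> forall k j, U i k = U i j.
Proof.
move=> di0; suff h : forall k j, adj k j -> U i k = U i j.
  by move=> k j; apply: (connect_constant h).
move=> k j akj.
have /esym/eqP := d_form i; rewrite di0 mul0rn psumr_eq0; last first.
  by move=> ? _; apply: sumr_ge0 => ? _; rewrite mulr_ge0 ?ler0n ?exprn_ge0.
move=> /allP/(_ k (mem_index_enum _)) /=; rewrite psumr_eq0; last first.
  by move=> ? _; rewrite mulr_ge0 ?ler0n ?exprn_ge0.
move=> /allP/(_ j (mem_index_enum _)) /=.
by rewrite akj mul1r expf_eq0 /= normr_eq0 subr_eq0 => /eqP.
Qed.

(** Two kernel eigenvectors are nonzero constants, so their inner product is [N] times a nonzero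
    number; distinct rows of [U] are orthogonal. *)
Let d_uniq0 i j : d i = 0 -> d j = 0 -> i = j.
Proof.
move=> di dj; apply/eqP/negP => /negP ij.
have nz l : d l = 0 -> U l i != 0.
  move=> dl; apply/eqP => U0; have /eqP := row_norm l l.
  rewrite eqxx mxE big1 ?[0 == _]eq_sym ?oner_eq0 // => k _.
  by rewrite !mxE (d_eq0 dl k i) U0 mul0r.
have := row_norm i j; rewrite (negbTE ij) mxE.
have e k : (row i U) 0 k * ((row j U)^t*) k 0 = U i i * (U j i)^*.
  by rewrite !mxE (d_eq0 di k i) (d_eq0 dj k i).
rewrite (eq_bigr _ (fun k _ => e k)) sumr_const card_ord => /eqP.
rewrite mulrn_eq0 mulf_eq0 conjC_eq0 (negbTE (nz _ di)) (negbTE (nz _ dj)) !orbF.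
by move=> /eqP N0; move: (ltn_ord i); rewrite {2}N0.
Qed.

(** Both lists are the roots with multiplicity of one complex polynomial, because unitary similarity
    preserves the characteristic polynomial. *)
Let d_lam : perm_eq [seq x%:C | x <- lam] [seq d i | i <- index_enum 'I_N].
Proof.
apply: prod_XsubC_eq; rewrite !big_map.
transitivity (char_poly LC).
  rewrite /LC -map_char_poly lam_char rmorph_prod; apply: eq_bigr => x _.
  by rewrite rmorphB /= map_polyX map_polyC.
transitivity (char_poly (diag_mx (spectral_diag LC))); last first.
  rewrite char_poly_trig ?diag_mx_is_trig //; apply: eq_bigr => i _.
  by rewrite mxE eqxx.
pose UP := map_mx polyC U; pose UtP := map_mx polyC (U^t*).
have UtU : UtP *m UP = 1%:M by rewrite -map_mxM (mulmx1C U_unit) map_mx1.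
rewrite /char_poly.
suff -> : char_poly_mx LC
    = UtP *m char_poly_mx (diag_mx (spectral_diag LC)) *m UP.
  by rewrite !det_mulmx mulrC mulrA -det_mulmx (mulmx1C UtU) det1 mul1r.
rewrite /char_poly_mx mulmxBr mulmxBl (scalar_mxC _ UtP).
rewrite -(mulmxA ('X%:M) UtP UP) UtU mulmx1.
by rewrite {1}LC_spec !map_mxM.
Qed.

Let size_lam : size lam = N.
Proof.
apply: succn_inj; rewrite -(size_char_poly (laplacian R adj)) lam_char.
by rewrite size_prod_XsubC.
Qed.

Let lam_d x : x \in lam -> exists i, d i = x%:C.
Proof.
move=> xl; have : x%:C \in [seq d i | i <- index_enum 'I_N].
  by rewrite -(perm_mem d_lam) map_f.
by move=> /mapP[i _ ->]; exists i.
Qed.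

Let lam_ge0 x : x \in lam -> 0 <= x.
Proof. by move=> /lam_d[i di]; rewrite -ler0c -di. Qed.

Let zero_lam : (0 < N)%N -> 0 \in lam.
Proof.
move=> N0; rewrite -root_prod_XsubC -lam_char -eigenvalue_root_char.
apply/eigenvalueP; exists (const_mx 1).
  apply/rowP => j; rewrite scale0r !mxE.
  have degE : (deg adj j)%:R = \sum_i (adj i j)%:R :> R.
    rewrite /deg -sum1_card natr_sum big_mkcond /=; apply: eq_bigr => i _.
    by rewrite inE adjC; case: (adj i j).
  rewrite (eq_bigr (fun i => (i == j)%:R * (deg adj i)%:R - (adj i j)%:R)).
    rewrite sumrB (bigD1 j) //= eqxx mul1r big1 ?addr0 ?degE ?subrr //.
    by move=> i /negbTE ->; rewrite mul0r.
  by move=> i _; rewrite !mxE mul1r.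
apply/eqP => /rowP/(_ (Ordinal N0)); rewrite !mxE => /eqP.
by rewrite oner_eq0.
Qed.

(** If the second entry were 0, so would be the first, and 0 would be a double root; [d_uniq0] makes
    it simple. *)
Lemma algebraic_connectivity_gt0 : (1 < N)%N -> 0 < lam`_1.
Proof.
move=> N2; have s1 : (1 < size lam)%N by rewrite size_lam.
have g1 : 0 <= lam`_1 by apply: lam_ge0; rewrite mem_nth.
have g0 : 0 <= lam`_0 by apply: lam_ge0; rewrite mem_nth // (ltn_trans _ s1).
rewrite lt_def g1 andbT; apply/eqP => l1.
have l0 : lam`_0 = 0.
  apply/le_anti; rewrite g0 andbT -[leRHS]l1.
  apply: (sorted_leq_nth le_trans lexx 0 lam_sorted) => //.
  by rewrite inE (ltn_trans _ s1).
have : (1 < count_mem 0%R [seq x%:C | x <- lam])%N.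
  move: l0 l1 s1; case: (lam) => [//|a [//|b' l]] /= -> -> _.
  by rewrite eqxx.
rewrite (permP d_lam); apply/negP; rewrite -leqNgt.
rewrite count_map -size_filter.
case E : (seq.filter _ _) => [|i [|j l]] //.
have hf k : k \in [:: i, j & l] -> d k = 0.
  by rewrite -E mem_filter => /andP[/eqP].
have ij : i = j by apply: d_uniq0; apply: hf; rewrite !inE eqxx ?orbT.
have : uniq [:: i, j & l] by rewrite -E filter_uniq // index_enum_uniq.
by rewrite /= ij inE eqxx.
Qed.

(** In the eigenbasis, the coefficient of [y] along the constant eigenvector vanishes, and every
    other eigenvalue is at least the second entry of [lam]. *)
Lemma laplacian_spectral_gap (y : 'I_N -> R) : \sum_i y i = 0 ->
  lam`_1 * (\sum_i y i ^+ 2) <= \sum_i \sum_j y i * laplacian R adj i j * y j.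
Proof.
move=> y0; pose v : 'rV[C]_N := \row_i (y i)%:C.
pose w : 'rV[C]_N := v *m U^t*.
have conjR (x : R) : Num.conj (x%:C : C) = x%:C.
  by apply/CrealP/complex_realP; exists x.
have UtU : U^t* *m U = 1%:M by rewrite (mulmx1C U_unit).
have wt : w^t* = U *m v^t*.
  by rewrite /w trmx_mul map_mxM trmxCK.
have nw : \sum_i `|w 0 i| ^+ 2 = (\sum_i y i ^+ 2)%:C.
  transitivity ((w *m w^t*) 0 0).
    by rewrite mxE; apply: eq_bigr => i _; rewrite !mxE normCK.
  rewrite wt /w -mulmxA (mulmxA (U^t*)) UtU mul1mx mxE rmorph_sum.
  by apply: eq_bigr => i _; rewrite !mxE conjR expr2 rmorphM.
have fw : \sum_i d i * `|w 0 i| ^+ 2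
    = (\sum_i \sum_j y i * laplacian R adj i j * y j)%:C.
  transitivity ((w *m diag_mx (spectral_diag LC) *m w^t*) 0 0).
    rewrite mxE; apply: eq_bigr => i _; rewrite mul_mx_diag !mxE normCK.
    by rewrite mulrCA mulrA.
  rewrite wt /w -!mulmxA (mulmxA (U^t*)) (mulmxA _ U) -LC_spec mulmxA mxE.
  rewrite exchange_big rmorph_sum /=; apply: eq_bigr => j _.
  rewrite mxE mulr_suml rmorph_sum; apply: eq_bigr => i _.
  by rewrite !mxE conjR -!rmorphM.
rewrite -lecR (rmorphM (real_complex R)) /= -nw -fw mulr_sumr; apply: ler_sum => i _.
have [di|di] := eqVneq (d i) 0.
  suff -> : w 0 i = 0 by rewrite normr0 expr0n /= !mulr0.
  rewrite mxE (eq_bigr (fun k => (y k)%:C * (U i i)^*)).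
    by rewrite -mulr_suml -rmorph_sum y0 mul0r.
  by move=> k _; rewrite !mxE (d_eq0 di k i).
apply: ler_wpM2r; first by rewrite exprn_ge0.
have : d i \in [seq x%:C | x <- lam].
  by rewrite (perm_mem d_lam) map_f // mem_index_enum.
move=> /mapP[x xl dx]; rewrite dx lecR.
apply: (@sorted_nth1_le _ _ 0) => //.
  by apply: zero_lam; apply: leq_ltn_trans (ltn_ord i).
rewrite lt_def lam_ge0 // andbT; apply: contra di => /eqP x0.
by rewrite dx x0.
Qed.

End Fiedler.

(** * Euclidean and spectral norms *)

Section SpectralNorm.
Variable R : realType.

Lemma sum_sqr_ge0 (I : finType) (u : I -> R) : 0 <= \sum_i u i ^+ 2.
Proof. by apply: sumr_ge0 => i _; rewrite sqr_ge0. Qed.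

Lemma Cauchy_Schwarz_sum (I : finType) (u w : I -> R) :
  (\sum_i u i * w i) ^+ 2 <= (\sum_i u i ^+ 2) * (\sum_i w i ^+ 2).
Proof.
set A := \sum_i u i ^+ 2; set B := \sum_i u i * w i.
set D := \sum_i w i ^+ 2.
have D0 : 0 <= D by apply: sum_sqr_ge0.
have e : \sum_i (D * u i - B * w i) ^+ 2 = D * (A * D - B ^+ 2).
  transitivity (D ^+ 2 * A - 2 * D * B * B + B ^+ 2 * D); last by ring.
  rewrite (eq_bigr (fun i => D ^+ 2 * u i ^+ 2 - 2 * D * B * (u i * w i)
    + B ^+ 2 * w i ^+ 2)) => [|i _]; last by ring.
  by rewrite big_split sumrB /= -!mulr_sumr.
have := sum_sqr_ge0 (fun i => D * u i - B * w i); rewrite e.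
have [D0' _|Dn0] := eqVneq D 0.
  rewrite D0' mulr0 /B big1 ?expr0n // => i _.
  have /eqP := D0'; rewrite psumr_eq0 => [|j _]; last exact: sqr_ge0.
  move=> /allP/(_ i (mem_index_enum _)) /=.
  by rewrite sqrf_eq0 => /eqP ->; rewrite mulr0.
by rewrite pmulr_rge0 ?subr_ge0 // lt_def Dn0.
Qed.

Lemma vnorm_ge0 (m : nat) (v : 'cV[R]_m) : 0 <= vnorm v.
Proof. exact: sqrtr_ge0. Qed.

Lemma vnorm_sqr (m : nat) (v : 'cV[R]_m) : vnorm v ^+ 2 = \sum_i v i 0 ^+ 2.
Proof. by rewrite sqr_sqrtr // sum_sqr_ge0. Qed.

Lemma sum_mul_le_vnorm (m : nat) (u v : 'cV[R]_m) :
  `|\sum_i u i 0 * v i 0| <= vnorm u * vnorm v.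
Proof.
rewrite -(@ler_pXn2r _ 2) ?nnegrE ?mulr_ge0 ?vnorm_ge0 // exprMn !vnorm_sqr.
by rewrite real_normK ?num_real // Cauchy_Schwarz_sum.
Qed.

Lemma vnormZ (m : nat) (k : R) (v : 'cV[R]_m) : vnorm (k *: v) = `|k| * vnorm v.
Proof.
apply/eqP; rewrite -(@eqrXn2 _ 2) ?mulr_ge0 ?vnorm_ge0 // exprMn !vnorm_sqr.
rewrite real_normK ?num_real // mulr_sumr; apply/eqP; apply: eq_bigr => i _.
by rewrite mxE exprMn.
Qed.

Lemma vnorm_eq0 (m : nat) (v : 'cV[R]_m) : vnorm v = 0 -> v = 0.
Proof.
move=> v0; apply/colP => i; rewrite mxE; have := vnorm_sqr v.
rewrite v0 expr0n /= => /esym/eqP.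
rewrite psumr_eq0 => [|j _]; last exact: sqr_ge0.
by move=> /allP/(_ i (mem_index_enum _)) /=; rewrite sqrf_eq0 => /eqP.
Qed.

Lemma vnorm0 (m : nat) : vnorm (0 : 'cV[R]_m) = 0.
Proof. by rewrite /vnorm big1 ?sqrtr0 // => i _; rewrite mxE expr0n. Qed.

(** This makes the [sup] in [specnorm] a true supremum; the Frobenius norm is an upper bound by
    Cauchy-Schwarz on each row. *)
Lemma specnorm_has_sup (m k : nat) (Mx : 'M[R]_(m, k)) :
  has_sup [set vnorm (Mx *m v) | v in [set v : 'cV[R]_k | vnorm v <= 1]].
Proof.
split.
  by exists (vnorm (Mx *m 0)), 0 => //=; rewrite vnorm0.
exists (Num.sqrt (\sum_i \sum_j Mx i j ^+ 2)) => _ [v /= v1 <-].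
rewrite ler_wsqrtr //; apply: ler_sum => i _; rewrite mxE.
apply: le_trans (Cauchy_Schwarz_sum _ _) _.
rewrite ler_piMr ?sum_sqr_ge0 // -vnorm_sqr.
by rewrite expr_le1 // vnorm_ge0.
Qed.

Lemma specnorm_ge0 (m k : nat) (Mx : 'M[R]_(m, k)) : 0 <= specnorm Mx.
Proof.
have [_ ub] := specnorm_has_sup Mx.
apply: le_trans (vnorm_ge0 (Mx *m 0)) _; apply: ub_le_sup => //; exists 0 => //=.
by rewrite vnorm0.
Qed.

Lemma vnorm_mulmx_le (m k : nat) (Mx : 'M[R]_(m, k)) (v : 'cV[R]_k) :
  vnorm (Mx *m v) <= specnorm Mx * vnorm v.
Proof.
have [v0|vn0] := eqVneq (vnorm v) 0.
  by rewrite (vnorm_eq0 v0) mulmx0 !vnorm0 mulr0.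
have vp : 0 < vnorm v by rewrite lt_def vn0 vnorm_ge0.
rewrite -ler_pdivrMr // mulrC -[X in X * _]ger0_norm ?invr_ge0 ?vnorm_ge0 //.
rewrite -vnormZ scalemxAr; have [_ ub] := specnorm_has_sup Mx.
apply: ub_le_sup => //; exists ((vnorm v)^-1 *: v) => //=.
by rewrite vnormZ ger0_norm ?invr_ge0 ?vnorm_ge0 // mulVf.
Qed.

Lemma bilinear_le_specnorm (m k : nat) (Mx : 'M[R]_(m, k)) (u : 'cV[R]_m)
    (v : 'cV[R]_k) :
  `|\sum_i u i 0 * (Mx *m v) i 0| <= specnorm Mx * (vnorm u * vnorm v).
Proof.
apply: le_trans (sum_mul_le_vnorm _ _) _; rewrite mulrCA.
by rewrite ler_wpM2l ?vnorm_ge0 ?vnorm_mulmx_le.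
Qed.

End SpectralNorm.

(** * Scalar recursions *)

Section ScalarRecursion.
Variable R : realType.

Lemma sum_harmonic_unbounded (m : nat) (A : R) :
  exists n, A < \sum_(0 <= i < n) ((m + i).+1%:R)^-1.
Proof.
apply: contrapT => /forallNP h.
have hb n : \sum_(0 <= i < n) ((m + i).+1%:R : R)^-1 <= A.
  by rewrite leNgt; apply/negP.
apply: (@dvg_harmonic R); apply: nondecreasing_is_cvgn.
  by apply: nondecreasing_series => i _ _; exact: harmonic_ge0.
exists (\sum_(0 <= i < m) (i.+1%:R)^-1 + A) => _ [n _ <-].
apply: (@le_trans _ _ (series (@harmonic R) (m + n))).
  rewrite /series /= [leRHS](@big_cat_nat _ _ _ n) //=.
    by rewrite lerDl sumr_ge0 // => i _; rewrite invr_ge0.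
  exact: leq_addl.
rewrite /series /= (@big_cat_nat _ _ _ m) //= ?leq_addr // lerD2l.
rewrite -{1}(add0n m) big_addn addKn; apply: le_trans (hb n).
by rewrite le_eqVlt; apply/orP; left; apply/eqP/eq_bigr => i _; rewrite addnC.
Qed.

(* Above any level [e > 0] the contraction [- mu * z k / t] eventually dominates
   the perturbation [c / t ^+ 2], so [z] loses at least a fixed multiple of the
   divergent harmonic series until it drops below [e], where it stays. *)
Lemma recursion_cvg0 (z : nat -> R) (m : nat) (mu c : R) :
  0 < mu -> 0 <= c -> (forall k, 0 <= z k) ->
  (forall k, z k.+1 <= (1 - mu / (m + k).+1%:R) * z k
                       + c / (m + k).+1%:R ^+ 2) ->
  z @ \oo --> (0 : R).
Proof.
move=> mu0 c0 z0 zrec.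
pose t k : R := (m + k).+1%:R.
have t0 k : 0 < t k by rewrite ltr0Sn.
suff H (e : R) : 0 < e -> exists K, forall k, (K <= k)%N -> z k <= e.
  apply/cvgrPdist_le => e e0; have [K hK] := H e e0.
  exists K => // k /= Kk; rewrite sub0r normrN ger0_norm //; exact: hK.
move=> e0.
have [K0 hK0] : exists K, forall k, (K <= k)%N ->
    mu <= t k /\ 2 * c / (mu * e) <= t k.
  (* Beyond the first value the factor [1 - mu / t] is nonnegative; beyond the second the
     perturbation is at most half of the contraction at level [e]. *)
  pose B := Num.max mu (2 * c / (mu * e)).
  exists (Num.bound B) => k hk.
  have : B <= t k.
    apply: ltW; apply: (lt_le_trans (archi_boundP _)).
      by rewrite le_max (ltW mu0).
    by rewrite ler_nat (leq_trans hk) // (leq_trans (leq_addl m k)) // leqnSn.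
  by rewrite ge_max => /andP.
have pert k : (K0 <= k)%N -> c / t k ^+ 2 <= mu * e / 2 / t k.
  move=> /hK0[_ h]; rewrite expr2 invfM mulrA ler_pM2r ?invr_gt0 //.
  rewrite ler_pdivrMr //; move: h; rewrite ler_pdivrMr ?mulr_gt0 //; lra.
have contr k : (K0 <= k)%N -> 0 <= 1 - mu / t k.
  by move=> /hK0[h _]; rewrite subr_ge0 ler_pdivrMr ?mul1r.
have stay k : (K0 <= k)%N -> z k <= e -> z k.+1 <= e.
  move=> hk ze; apply: le_trans (zrec k) _.
  apply: (@le_trans _ _ ((1 - mu / t k) * e + mu * e / 2 / t k)).
    by apply: lerD; [apply: ler_wpM2l => //; apply: contr | apply: pert].
  have : 0 <= mu / t k * e by rewrite mulr_ge0 ?divr_ge0 ?ltW.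
  have -> : mu * e / 2 / t k = mu / t k * e / 2 by rewrite mulrAC [mu * e / _]mulrAC.
  by rewrite mulrBl mul1r; set q := mu / t k * e; lra.
have [K hK zK] : exists2 K, (K0 <= K)%N & z K <= e.
  apply: contrapT => hno.
  have big k : (K0 <= k)%N -> e < z k.
    by move=> hk; rewrite ltNge; apply/negP => hz; apply: hno; exists k.
  have dec n : z (K0 + n)%N
      <= z K0 - mu * e / 2 * \sum_(0 <= i < n) ((m + K0 + i).+1%:R)^-1.
    elim: n => [|n IH]; first by rewrite addn0 big_geq // mulr0 subr0.
    rewrite addnS big_nat_recr //= mulrDr opprD addrA.
    apply: le_trans (zrec _) _.
    have hk : (K0 <= K0 + n)%N by rewrite leq_addr.
    have := pert _ hk; rewrite -/(t (K0 + n)%N) => h1.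
    have h2 : mu / t (K0 + n)%N * e <= mu / t (K0 + n)%N * z (K0 + n)%N.
      by apply: ler_wpM2l; [rewrite divr_ge0 ?ltW | apply/ltW/big].
    rewrite -[(m + K0 + n)%N]addnA -/(t (K0 + n)%N).
    have e1 : mu * e / 2 / t (K0 + n)%N = mu / t (K0 + n)%N * e / 2.
      by rewrite mulrAC [mu * e / _]mulrAC.
    move: h1 IH h2; rewrite mulrBl mul1r e1.
    have aux (q q' S w zk zK : R) : w <= q / 2 -> zk <= zK - S -> q <= q' ->
      zk - q' + w <= zK - S - q / 2 by lra.
    exact: aux.
  have [n hn] := sum_harmonic_unbounded (m + K0) (z K0 / (mu * e / 2)).
  have := le_trans (z0 _) (dec n); rewrite subr_ge0 leNgt => /negP; apply.
  by rewrite ltr_pdivrMr in hn; [rewrite mulrC | rewrite !mulr_gt0 ?invr_gt0].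
exists K => k /subnK <-; elim: (k - K)%N => [//|l IH].
by rewrite addSn; apply: stay => //; apply: leq_trans hK (leq_addl _ _).
Qed.

(** Inserting the trial bound [C / t] leaves a surplus whose leading part is
    [((mu - 1) * C - c) / t ^+ 2]; this is where [mu > 1] enters. *)
Lemma recursion_bound (z : nat -> R) (m : nat) (mu c B : R) :
  1 < mu -> 0 <= c -> (forall k, 0 <= z k <= B) ->
  (forall k, z k.+1 <= (1 - mu / (m + k).+2%:R) * z k
                       + c / (m + k).+2%:R ^+ 2) ->
  exists C : R, 0 < C /\ forall k, z k <= C / (m + k).+1%:R.
Proof.
move=> mu1 c0 zB zrec.
have B0 : 0 <= B by have /andP[h1 h2] := zB 0%N; exact: le_trans h2.
have mu0 : 0 < mu by apply: lt_trans mu1.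
(* The summands serve, in order, the perturbation, the early times with [s < mu] where the factor is
   negative and only the bound [B] helps, the base case, and positivity of [C]. *)
pose C := c / (mu - 1) + B * mu + B * m.+1%:R + 1.
have m1 : 0 < mu - 1 by rewrite subr_gt0.
have q1 : 0 <= c / (mu - 1) by rewrite divr_ge0 // ltW.
have q2 : 0 <= B * mu by rewrite mulr_ge0 // ltW.
have q3 : 0 <= B * m.+1%:R by rewrite mulr_ge0.
have C0 : 0 < C by rewrite /C; lra.
exists C; split => //; elim=> [|k IH].
  have /andP[_ h] := zB 0%N; rewrite addn0 ler_pdivlMr ?ltr0Sn //.
  apply: le_trans (ler_wpM2r _ h) _ => //; rewrite /C; lra.
rewrite addnS; set s : R := (m + k).+2%:R.
have s0 : 0 < s by rewrite ltr0Sn.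
have [hs|hs] := ltP s mu.
  have /andP[_ h] := zB k.+1; rewrite ler_pdivlMr //.
  apply: le_trans (ler_wpM2r (ltW s0) h) _.
  have := ler_wpM2l B0 (ltW hs); rewrite /C; lra.
apply: le_trans (zrec k) _; rewrite -/s.
have co : 0 <= 1 - mu / s by rewrite subr_ge0 ler_pdivrMr ?mul1r.
have IH' := ler_wpM2l co IH.
apply: le_trans (lerD IH' (lexx _)) _.
have sE : s = (m + k).+1%:R + 1 by rewrite /s -natr1.
set r : R := (m + k).+1%:R in sE *.
have r0 : 0 < r by rewrite ltr0Sn.
have cC : c <= (mu - 1) * C.
  have e : (mu - 1) * (c / (mu - 1)) = c by rewrite mulrCA divff ?mulr1 ?gt_eqF.
  rewrite /C !mulrDr e.
  have : 0 <= (mu - 1) * (B * mu) by rewrite mulr_ge0 // ltW.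
  have : 0 <= (mu - 1) * (B * m.+1%:R) by rewrite mulr_ge0 // ltW.
  lra.
rewrite -subr_ge0.
have -> : C / s - ((1 - mu / s) * (C / r) + c / s ^+ 2)
   = (((mu - 1) * C - c) * r + (mu - 1) * C) / (r * s ^+ 2).
  rewrite sE; field; rewrite -?sE; apply/andP; split; exact: lt0r_neq0.
apply: divr_ge0; last by rewrite mulr_ge0 ?sqr_ge0 ?ltW.
have h1 : 0 <= ((mu - 1) * C - c) * r by rewrite mulr_ge0 ?subr_ge0 // ltW.
have h2 : 0 <= (mu - 1) * C by rewrite mulr_ge0 // ltW.
lra.
Qed.

End ScalarRecursion.

(** * The Gaussian distribution function *)

Lemma half_line_measurable (R : realType) (x : R) : measurable [set y : R | y <= x].
Proof.
have -> : [set y : R | y <= x] = `]-oo, x]%classic.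
  by apply/seteqP; split => y /=; rewrite in_itv.
exact: measurable_itv.
Qed.

Section NormalCdf.
Variables (R : realType) (sigma : R).
Hypothesis sigma0 : 0 < sigma.

Let sigma_neq0 : sigma != 0. Proof. by rewrite gt_eqF. Qed.

Lemma fnorm_gt0 (x : R) : 0 < fnorm sigma x.
Proof. by rewrite /fnorm normal_pdfE // mulr_gt0 ?normal_peak_gt0 ?expR_gt0. Qed.

Lemma fnorm_le (r x : R) : `|x| <= r -> fnorm sigma r <= fnorm sigma x.
Proof.
move=> xr; rewrite /fnorm normal_pdfE // ler_wpM2l ?normal_peak_ge0 //.
rewrite ler_expR !subr0 ler_wpM2r ?invr_ge0 ?mulrn_wge0 ?sqr_ge0 //.
rewrite lerN2 -[x ^+ 2]real_normK ?num_real // ler_pXn2r ?nnegrE //.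
exact: le_trans xr.
Qed.

Lemma Fnorm_fin (x : R) :
  normal_prob 0 sigma [set y : R | y <= x] = (Fnorm sigma x)%:E.
Proof.
rewrite /Fnorm fineK //; apply: fin_num_measure; exact: half_line_measurable.
Qed.

Lemma Fnorm_itv01 (x : R) : 0 <= Fnorm sigma x <= 1.
Proof.
rewrite -!lee_fin -Fnorm_fin measure_ge0 probability_le1 //.
exact: half_line_measurable.
Qed.

(** The increment is the mass of []u, v]]. The density is even and decreasing in the modulus, so on
    this interval it is at least its value at [r]. *)
Lemma Fnorm_increment (r u v : R) : `|u| <= r -> `|v| <= r -> u <= v ->
  fnorm sigma r * (v - u) <= Fnorm sigma v - Fnorm sigma u.
Proof.
move=> ur vr uv; rewrite lerBrDl -lee_fin EFinD -!Fnorm_fin.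
have -> : [set y : R | y <= v] = [set y : R | y <= u] `|` `]u, v]%classic.
  apply/seteqP; split => y /=; rewrite in_itv /=.
    by move=> yv; have [yu|yu] := leP y u; [left | right].
  by move=> [yu|/andP[]//]; exact: le_trans uv.
rewrite measureU //=; first last.
  apply/seteqP; split => y //= []; rewrite in_itv /= => yu /andP[uy _].
  by move: yu; rewrite leNgt uy.
  exact: half_line_measurable.
apply: leeD => //; rewrite /normal_prob.
apply: (@le_trans _ _
  (\int[lebesgue_measure]_(x in `]u, v]) (cst (fnorm sigma r)%:E x))%E).
  rewrite integral_cst //= lebesgue_measure_itv /= lte_fin.
  move: uv; rewrite le_eqVlt => /predU1P[->|->]; last by [].
  by rewrite subrr mulr0 ltxx mule0.
apply: ge0_le_integral => //=.
- by move=> x _; rewrite lee_fin ltW ?fnorm_gt0.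
- apply/measurable_EFinP; apply: measurable_funTS; exact: measurable_normal_pdf.
move=> x; rewrite /= in_itv /= => /andP[ux xv]; rewrite lee_fin fnorm_le //.
move: ur vr; rewrite !ler_norml => /andP[ru _] /andP[_ vr].
by rewrite (le_trans ru (ltW ux)) (le_trans xv vr).
Qed.

Lemma Fnorm_strong_monotone (r u v : R) : `|u| <= r -> `|v| <= r ->
  fnorm sigma r * (v - u) ^+ 2 <= (v - u) * (Fnorm sigma v - Fnorm sigma u).
Proof.
move=> ur vr; have [uv|/ltW vu] := leP u v.
  rewrite expr2 mulrCA ler_wpM2l ?subr_ge0 //; exact: Fnorm_increment.
rewrite -(opprB u v) -(opprB (Fnorm sigma u)) sqrrN mulrNN.
rewrite expr2 mulrCA ler_wpM2l ?subr_ge0 //; exact: Fnorm_increment.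
Qed.

End NormalCdf.

Section MinimalDensity.
Variables (R : realType) (N : nat) (adj : rel 'I_N) (c : 'I_N -> 'I_N -> R).
Variables (sigma M : R).

Lemma fM_gt0 : 0 < sigma -> 0 < fM adj c sigma M.
Proof.
move=> s0; rewrite /fM; elim/big_ind: _ => [|x y x0 y0|p _]; rewrite ?fnorm_gt0 //.
by rewrite lt_min x0.
Qed.

Lemma fM_le i j : adj i j -> fM adj c sigma M <= fnorm sigma (`|c i j| + M).
Proof.
by move=> aij; rewrite /fM (bigD1 (i, j)) ?inE //= ge_min lexx.
Qed.

End MinimalDensity.

(** * Averages, disagreement and clipping *)

Section Mean.
Variables (R : realType) (N : nat).
Hypothesis N0 : (0 < N)%N.

Definition mean (y : 'I_N -> R) : R := N%:R^-1 * \sum_i y i.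

Lemma sum_sub_mean (y : 'I_N -> R) : \sum_i (y i - mean y) = 0.
Proof.
rewrite sumrB sumr_const card_ord -[X in _ - X]mulr_natl /mean mulrA mulfV.
  by rewrite mul1r subrr.
by rewrite pnatr_eq0 -lt0n.
Qed.

Lemma meanD (y g : 'I_N -> R) (h : R) :
  mean (fun i => y i + h * g i) = mean y + h * mean g.
Proof. by rewrite /mean big_split /= -mulr_sumr mulrDr mulrCA. Qed.

Definition disagreement (y : 'I_N -> R) : R := \sum_i (y i - mean y) ^+ 2.

Lemma disagreement_le (g : 'I_N -> R) : disagreement g <= \sum_i g i ^+ 2.
Proof.
have -> : \sum_i g i ^+ 2 = disagreement g + \sum_(i < N) mean g ^+ 2
    + 2 * mean g * (\sum_i (g i - mean g)).
  rewrite mulr_sumr /disagreement -!big_split /=.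
  by apply: eq_bigr => i _; ring.
by rewrite sum_sub_mean mulr0 addr0 lerDl sumr_ge0 // => i _; exact: sqr_ge0.
Qed.

Lemma disagreement_step (y g : 'I_N -> R) (h : R) :
  disagreement (fun i => y i + h * g i)
  = disagreement y + 2 * h * (\sum_i (y i - mean y) * g i)
    + h ^+ 2 * disagreement g.
Proof.
(* Deviations from the mean sum to zero, so [g] can be centred for free. *)
have -> : \sum_i (y i - mean y) * g i
    = \sum_i (y i - mean y) * (g i - mean g).
  rewrite [RHS](eq_bigr (fun i => (y i - mean y) * g i
     - (y i - mean y) * mean g)) => [|i _]; last by rewrite mulrBr.
  by rewrite sumrB -mulr_suml sum_sub_mean mul0r subr0.
rewrite /disagreement meanD !mulr_sumr -!big_split /=.
by apply: eq_bigr => i _; ring.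
Qed.

End Mean.

Lemma projM_norm (R : realType) (M z : R) : 0 < M -> `|projM M z| <= M.
Proof.
move=> M0; rewrite /projM ler_norml le_max lexx ge_max ge_min lexx /= andbT.
by apply: le_trans (ltW M0); rewrite oppr_le0 ltW.
Qed.

Lemma projM_nonexpansive (R : realType) (M z a : R) : `|a| <= M ->
  (projM M z - a) ^+ 2 <= (z - a) ^+ 2.
Proof.
rewrite ler_norml /projM /Num.max /Num.min => /andP[aM Ma].
by case: (ltP M z) => Mz; case: ltP => hz; nra.
Qed.

(** * First-order drift of the two errors *)

Section OneStep.
Variables (R : realType) (N : nat) (adj : rel 'I_N).
Hypothesis N0 : (0 < N)%N.
Implicit Types (y : 'I_N -> R) (z : 'I_N -> 'I_N -> R).

Definition drift y z i : R := \sum_(j | adj i j) (z i j - y i).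

Definition estimation_error y z : R :=
  \sum_(p in edges adj) (z p.1 p.2 - y p.2) ^+ 2.

Definition dvec y : 'cV[R]_N := \col_i (y i - mean y).
Definition evec y z : 'cV[R]_#|edges adj| :=
  \col_p (z (enum_val p).1 (enum_val p).2 - y (enum_val p).2).

Lemma sum_edges (f : 'I_N * 'I_N -> R) :
  \sum_(p in edges adj) f p = \sum_(k < #|edges adj|) f (enum_val k).
Proof. exact: big_enum_val. Qed.

Lemma dvec_vnorm y : vnorm (dvec y) ^+ 2 = disagreement y.
Proof. by rewrite vnorm_sqr; apply: eq_bigr => i _; rewrite mxE. Qed.

Lemma evec_vnorm y z : vnorm (evec y z) ^+ 2 = estimation_error y z.
Proof.
rewrite vnorm_sqr /estimation_error sum_edges.
by apply: eq_bigr => i _; rewrite mxE.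
Qed.

Lemma laplacian_dvec y i :
  (laplacian R adj *m dvec y) i 0 = \sum_(j | adj i j) (y i - y j).
Proof.
rewrite mxE.
have degE : (deg adj i)%:R = \sum_j (adj i j)%:R :> R.
  rewrite /deg -sum1_card natr_sum big_mkcond /=; apply: eq_bigr => j _.
  by rewrite inE; case: (adj i j).
transitivity ((deg adj i)%:R * (y i - mean y)
    - \sum_j (adj i j)%:R * (y j - mean y)).
  rewrite (eq_bigr (fun j => (i == j)%:R * ((deg adj i)%:R * (y j - mean y))
     - (adj i j)%:R * (y j - mean y))) => [|j _]; last by rewrite !mxE; ring.
  rewrite sumrB (bigD1 i) //= eqxx mul1r big1 ?addr0 // => j /negbTE.
  by rewrite eq_sym => ->; rewrite mul0r.
rewrite degE mulr_suml -sumrB [RHS]big_mkcond; apply: eq_bigr => j _.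
by case: (adj i j); rewrite ?mul1r ?mul0r ?subrr // opprB addrA subrK.
Qed.

Lemma Wmat_evec y z i :
  (Wmat R adj *m evec y z) i 0 = \sum_(j | adj i j) (z i j - y j).
Proof.
rewrite mxE.
transitivity (\sum_(p in edges adj) (p.1 == i)%:R * (z p.1 p.2 - y p.2)).
  by rewrite sum_edges; apply: eq_bigr => p _; rewrite !mxE.
rewrite [LHS]big_mkcond [RHS]big_mkcond /=.
rewrite (eq_bigr (fun p : 'I_N * 'I_N =>
    if adj p.1 p.2 then (p.1 == i)%:R * (z p.1 p.2 - y p.2) else 0)).
  rewrite -(pair_bigA _ (fun k j =>
    if adj k j then (k == i)%:R * (z k j - y j) else 0)) /=.
  rewrite (bigD1 i) //= [X in _ + X]big1 ?addr0.
    by apply: eq_bigr => j _; rewrite eqxx mul1r.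
  move=> k /negbTE ki; apply: big1 => j _; rewrite ki mul0r; by case: ifP.
by move=> p _; rewrite inE.
Qed.

Lemma drift_decomp y z :
  \col_i drift y z i = - (laplacian R adj *m dvec y) + Wmat R adj *m evec y z.
Proof.
apply/colP => i; rewrite [LHS]mxE [RHS]mxE [X in X + _]mxE.
rewrite laplacian_dvec Wmat_evec -sumrN -big_split /=.
by apply: eq_bigr => j _; ring.
Qed.

(** Deviations are orthogonal to constants. Inserting the projection [Jmat] makes the norm of J_N W,
    hence lambda_G, appear instead of that of W. *)
Lemma Jmat_dvec y (v : 'cV[R]_N) :
  \sum_i dvec y i 0 * (Jmat R N *m v) i 0 = \sum_i dvec y i 0 * v i 0.
Proof.
have Jv i : (Jmat R N *m v) i 0 = v i 0 - mean (fun i => v i 0).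
  rewrite /Jmat mulmxBl mul1mx -scalemxAl !mxE; congr (_ - _ * _).
  by apply: eq_bigr => j _; rewrite mxE mul1r.
rewrite (eq_bigr (fun i => dvec y i 0 * v i 0
   - dvec y i 0 * mean (fun i => v i 0))) => [|i _]; last by rewrite Jv mulrBr.
rewrite sumrB -mulr_suml.
rewrite [X in _ - X * _](eq_bigr (fun i => y i - mean y)) => [|i _].
  by rewrite sum_sub_mean // mul0r subr0.
by rewrite mxE.
Qed.

Lemma Qmat_mul (v : 'cV[R]_N) p : (Qmat R adj *m v) p 0 = v (enum_val p).2 0.
Proof.
rewrite mxE (bigD1 (enum_val p).2) //= mxE eqxx mul1r big1 ?addr0 // => k.
by rewrite mxE eq_sym => /negbTE ->; rewrite mul0r.
Qed.

Section Bounds.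
Variables (lambda2 : R).
Hypothesis lambda2_gt0 : 0 < lambda2.
Hypothesis gap : forall y, \sum_i y i = 0 ->
  lambda2 * (\sum_i y i ^+ 2) <= \sum_i \sum_j y i * laplacian R adj i j * y j.

Let nG := specnorm (Jmat R N *m Wmat R adj).
Let nQW := specnorm (Qmat R adj *m Wmat R adj).
Let nQL := specnorm (Qmat R adj *m laplacian R adj).

(** The Laplacian contracts at rate [2 * lambda2]; Young's inequality spends half of it on the cross
    term with the estimation error. *)
Lemma disagreement_drift y z :
  2 * (\sum_i (y i - mean y) * drift y z i)
  <= - lambda2 * disagreement y
     + nG ^+ 2 / lambda2 * estimation_error y z.
Proof.
have -> : \sum_i (y i - mean y) * drift y z i
   = - (\sum_i \sum_j (y i - mean y) * laplacian R adj i j * (y j - mean y))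
     + \sum_i dvec y i 0 * (Jmat R N *m Wmat R adj *m evec y z) i 0.
  rewrite -mulmxA Jmat_dvec -sumrN -big_split /=; apply: eq_bigr => i _.
  have /colP/(_ i) := drift_decomp y z; rewrite [LHS]mxE [RHS]mxE => ->.
  rewrite mulrDr; congr (_ + _); last by rewrite [dvec y i 0]mxE.
  rewrite [X in _ * X]mxE mulrN [X in _ * X]mxE mulr_sumr; congr (- _).
  by apply: eq_bigr => j _; rewrite [dvec y j 0]mxE mulrA.
have h1 := gap (sum_sub_mean N0 y); rewrite -/(disagreement y) in h1.
have h2 := le_trans (ler_norm _) (bilinear_le_specnorm
   (Jmat R N *m Wmat R adj) (dvec y) (evec y z)).
rewrite -/nG in h2; rewrite -dvec_vnorm in h1 *; rewrite -evec_vnorm.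
set a := vnorm (dvec y) in h1 h2 *; set b := vnorm (evec y z) in h2 *.
have h3 : 2 * (nG * (a * b)) <= lambda2 * a ^+ 2 + nG ^+ 2 / lambda2 * b ^+ 2.
  rewrite -subr_ge0.
  have -> : lambda2 * a ^+ 2 + nG ^+ 2 / lambda2 * b ^+ 2 - 2 * (nG * (a * b))
     = (lambda2 * a - nG * b) ^+ 2 / lambda2 by field; rewrite gt_eqF.
  by rewrite divr_ge0 ?sqr_ge0 // ltW.
have aux (x2 l s1 s2 t : R) : l <= s1 -> s2 <= t -> 2 * t <= l + x2 ->
   2 * (- s1 + s2) <= - l + x2 by lra.
rewrite [- lambda2 * _]mulNr. exact: (aux _ _ _ _ _ h1 h2 h3).
Qed.

(** The Young weight is tuned so that the disagreement gets the same coefficient [nG ^+ 2 / lambda2]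
    as the estimation error in [disagreement_drift]. Its price is the second term of alpha; the
    first comes from the errors moving the outputs that they track. *)
Lemma estimation_drift y z : 0 < nG ->
  - 2 * (\sum_(p in edges adj) (z p.1 p.2 - y p.2) * drift y z p.2)
  <= (2 * nQW + nQL ^+ 2 * lambda2 / nG ^+ 2) * estimation_error y z
     + nG ^+ 2 / lambda2 * disagreement y.
Proof.
move=> nG0.
have -> : \sum_(p in edges adj) (z p.1 p.2 - y p.2) * drift y z p.2
   = - (\sum_p evec y z p 0 * (Qmat R adj *m laplacian R adj *m dvec y) p 0)
     + \sum_p evec y z p 0 * (Qmat R adj *m Wmat R adj *m evec y z) p 0.
  rewrite sum_edges -sumrN -big_split /=; apply: eq_bigr => p _.
  rewrite -!mulmxA !Qmat_mul; set i := (enum_val p).2.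
  have /colP/(_ i) := drift_decomp y z; rewrite [LHS]mxE [RHS]mxE => ->.
  have -> : evec y z p 0 = z (enum_val p).1 i - y i by rewrite mxE.
  by rewrite [X in _ * (X + _)]mxE; ring.
have h1 := le_trans (ler_norm _) (bilinear_le_specnorm
   (Qmat R adj *m laplacian R adj) (evec y z) (dvec y)).
have h2 := bilinear_le_specnorm (Qmat R adj *m Wmat R adj) (evec y z) (evec y z).
rewrite ler_norml in h2; have {h2} /andP[h2 _] := h2.
rewrite -/nQL in h1; rewrite -/nQW in h2; rewrite -dvec_vnorm -evec_vnorm.
set a := vnorm (dvec y) in h1 h2 *; set b := vnorm (evec y z) in h1 h2 *.
have h3 : 2 * (nQL * (b * a)) <= nQL ^+ 2 * lambda2 / nG ^+ 2 * b ^+ 2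
    + nG ^+ 2 / lambda2 * a ^+ 2.
  rewrite -subr_ge0.
  have -> : nQL ^+ 2 * lambda2 / nG ^+ 2 * b ^+ 2 + nG ^+ 2 / lambda2 * a ^+ 2
     - 2 * (nQL * (b * a))
     = (nQL * lambda2 / nG * b - nG * a) ^+ 2 / lambda2.
    by field; rewrite !gt_eqF.
  by rewrite divr_ge0 ?sqr_ge0 // ltW.
have aux (x1 x2 s1 s2 t w : R) : s1 <= t -> - w <= s2 -> 2 * t <= x1 + x2 ->
   - 2 * (- s1 + s2) <= (2 * w + x1) + x2 by lra.
rewrite mulrDl -[2 * nQW * _]mulrA [in X in _ <= 2 * X + _ + _]expr2.
exact: (aux _ _ _ _ _ _ h1 h2 h3).
Qed.

End Bounds.
End OneStep.

(** * One step of the Lyapunov function *)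

Section LyapunovStep.
Variables (R : realType) (N : nat) (adj : rel 'I_N).
Hypothesis N0 : (0 < N)%N.
Variables (lambda2 : R).
Hypothesis lambda2_gt0 : 0 < lambda2.
Hypothesis gap : forall y, \sum_i y i = 0 ->
  lambda2 * (\sum_i y i ^+ 2) <= \sum_i \sum_j y i * laplacian R adj i j * y j.
Variables (c : 'I_N -> 'I_N -> R) (F : R -> R) (beta gamma M f : R).
Hypotheses (beta0 : 0 < beta) (gamma0 : 0 < gamma) (M0 : 0 < M) (f0 : 0 < f).
Hypothesis F01 : forall x, 0 <= F x <= 1.
Hypothesis Fmono : forall i j (a b : R), adj i j -> `|a| <= M -> `|b| <= M ->
  (a - b) * (F (c i j - a) - F (c i j - b)) <= - f * (a - b) ^+ 2.

Let nG := specnorm (Jmat R N *m Wmat R adj).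
Let nQW := specnorm (Qmat R adj *m Wmat R adj).
Let nQL := specnorm (Qmat R adj *m laplacian R adj).
Hypothesis nG0 : 0 < nG.
Let alpha := 2 * nQW + nQL ^+ 2 * lambda2 / nG ^+ 2.

Definition bounded_state (y : 'I_N -> R) (z : 'I_N -> 'I_N -> R) :=
  (forall i, `|y i| <= M) /\ (forall i j, adj i j -> `|z i j| <= M).

(** One [tau] serves both updates: from (y(t), zhat(t)) to (y(t+1), zhat(t+1)) the gains are
    gamma/(t+1) and beta/(t+1). *)
Definition next_y (tau : R) (y : 'I_N -> R) (z : 'I_N -> 'I_N -> R) i : R :=
  y i + gamma / tau * drift adj y z i.

Definition next_z (tau : R) (z : 'I_N -> 'I_N -> R) (s : 'I_N -> 'I_N -> R)
    i j : R :=
  projM M (z i j + beta / tau * (F (c i j - z i j) - s i j)).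

(** The bit is compared with [F] at the true new output [y'], its mean given the past, and not with
    [F] at the estimate as in the algorithm. *)
Definition innovation (y' : 'I_N -> R) (z : 'I_N -> 'I_N -> R)
    (s : 'I_N -> 'I_N -> R) : R :=
  \sum_(p in edges adj)
    (z p.1 p.2 - y' p.2) * (F (c p.1 p.2 - y' p.2) - s p.1 p.2).

Lemma drift_bound y z i : bounded_state y z ->
  `|drift adj y z i| <= 2 * M * N%:R.
Proof.
move=> [hy hz]; apply: le_trans (ler_norm_sum _ _ _) _.
apply: (@le_trans _ _ (\sum_(j < N) 2 * M)); last first.
  by rewrite sumr_const card_ord mulr_natr.
rewrite big_mkcond; apply: ler_sum => j _.
case: ifP => [aij|_]; last by rewrite mulr_ge0 ?ltW.
by apply: le_trans (ler_normB _ _) _; have := hz _ _ aij; have := hy i; lra.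
Qed.

Lemma drift_sqr_bound y z i : bounded_state y z ->
  drift adj y z i ^+ 2 <= (2 * M * N%:R) ^+ 2.
Proof.
move=> /(drift_bound i) h; rewrite -real_normK ?num_real //.
by rewrite ler_pXn2r ?nnegrE // (le_trans _ h).
Qed.

Lemma sum_nbrs_const i (x : R) : \sum_(j | adj i j) x = (deg adj i)%:R * x.
Proof.
by rewrite /deg mulr_natl -sumr_const; apply: eq_bigl => j; rewrite inE.
Qed.

(** The condition on [tau] makes the new output a convex combination of the old one and the neighbor
    estimates. *)
Lemma next_y_bound (tau : R) y z i : 0 < tau -> gamma * (dmax adj)%:R <= tau ->
  bounded_state y z -> `|next_y tau y z i| <= M.
Proof.
move=> tau0 htau [hy hz]; pose h := gamma / tau.
have h0 : 0 <= h by rewrite divr_ge0 ?ltW.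
have e : next_y tau y z i
    = (1 - h * (deg adj i)%:R) * y i + h * \sum_(j | adj i j) z i j.
  by rewrite /next_y /drift sumrB sum_nbrs_const -/h; ring.
have hd : 0 <= 1 - h * (deg adj i)%:R.
  rewrite subr_ge0 mulrAC ler_pdivrMr // mul1r (le_trans _ htau) //.
  by rewrite ler_pM2l // ler_nat; exact: leq_bigmax.
have hs : `|\sum_(j | adj i j) z i j| <= (deg adj i)%:R * M.
  apply: le_trans (ler_norm_sum _ _ _) _.
  by rewrite -sum_nbrs_const; apply: ler_sum => j; exact: hz.
rewrite e; apply: le_trans (ler_normD _ _) _.
rewrite normrM (ger0_norm hd) [`|h * _|]normrM (ger0_norm h0).
have h1 := ler_wpM2l hd (hy i); have h2 := ler_wpM2l h0 hs.
apply: le_trans (lerD h1 h2) _; rewrite le_eqVlt; apply/orP; left.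
by apply/eqP; ring.
Qed.

Lemma disagreement_next (tau : R) y z : 0 < tau -> bounded_state y z ->
  disagreement (next_y tau y z)
  <= disagreement y
     + (gamma * nG ^+ 2 / lambda2 * estimation_error adj y z
        - gamma * lambda2 * disagreement y) / tau
     + gamma ^+ 2 * (N%:R * (2 * M * N%:R) ^+ 2) / tau ^+ 2.
Proof.
move=> tau0 hb; rewrite disagreement_step // -addrA -[leRHS]addrA lerD2l.
apply: lerD.
  have := disagreement_drift N0 lambda2_gt0 gap y z; rewrite -/nG.
  set S := \sum_i _; move=> hS.
  have -> : 2 * (gamma / tau) * S = gamma * (2 * S) / tau by ring.
  rewrite ler_pM2r ?invr_gt0 //.
  apply: le_trans (ler_wpM2l (ltW gamma0) hS) _.
  by rewrite le_eqVlt; apply/orP; left; apply/eqP; ring.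
rewrite expr_div_n mulrAC ler_pM2r ?invr_gt0 ?exprn_gt0 //.
rewrite ler_pM2l ?exprn_gt0 //; apply: le_trans (disagreement_le N0 _) _.
apply: (@le_trans _ _ (\sum_(i < N) (2 * M * N%:R) ^+ 2)).
  by apply: ler_sum => i _; apply: drift_sqr_bound.
by rewrite sumr_const card_ord [leRHS]mulr_natl.
Qed.

Let d : R := #|edges adj|%:R.

Lemma estimation_error_next (tau : R) y z s : 0 < tau ->
  bounded_state y z -> (forall i, `|next_y tau y z i| <= M) ->
  (forall i j, 0 <= s i j <= 1) ->
  estimation_error adj (next_y tau y z) (next_z tau z s)
  <= estimation_error adj y z
     + (gamma * nG ^+ 2 / lambda2 * disagreement y
        - (2 * beta * f - gamma * alpha) * estimation_error adj y z) / tau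
     + (gamma ^+ 2 * (d * (2 * M * N%:R) ^+ 2)
        + 4 * beta * f * gamma * (d * (2 * M * (2 * M * N%:R)))
        + beta ^+ 2 * d) / tau ^+ 2
     + 2 * (beta / tau) * innovation (next_y tau y z) z s.
Proof.
move=> tau0 hb hy' hs; have [hy hz] := hb.
set y' := next_y tau y z; set h := gamma / tau; set k := beta / tau.
have h0 : 0 < h by rewrite divr_gt0.
have k0 : 0 < k by rewrite divr_gt0.
pose ep p := z p.1 p.2 - y p.2.
pose g i := drift adj y z i.
pose S := \sum_(p in edges adj) ep p * g p.2.
pose G2 := \sum_(p in edges adj) g p.2 ^+ 2.
have sumd (x : R) : \sum_(p in edges adj) x = d * x.
  by rewrite sumr_const mulr_natl.
have G2d : G2 <= d * (2 * M * N%:R) ^+ 2.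
  by rewrite -sumd; apply: ler_sum => p _; apply: drift_sqr_bound.
have Sd : S <= d * (2 * M * (2 * M * N%:R)).
  rewrite -sumd; apply: ler_sum => p; rewrite inE => ap.
  apply: le_trans (ler_norm _) _; rewrite normrM; apply: ler_pM => //.
    apply: le_trans (ler_normB _ _) _; have := hz _ _ ap; have := hy p.2; lra.
  exact: drift_bound.
(* [Fz - sp] is split as [(Fz - Fy) + (Fy - sp)]: the first part contracts by monotonicity, the
   second is the innovation, and the square of the whole is at most 1. *)
have step : estimation_error adj y' (next_z tau z s)
  <= \sum_(p in edges adj) ((1 - 2 * k * f) * (ep p - h * g p.2) ^+ 2
       + 2 * k * ((z p.1 p.2 - y' p.2) * (F (c p.1 p.2 - y' p.2) - s p.1 p.2))
       + k ^+ 2).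
  apply: ler_sum => p; rewrite inE => ap.
  apply: le_trans (projM_nonexpansive _ (hy' p.2)) _.
  have := Fmono ap (hz _ _ ap) (hy' p.2); rewrite -/y'.
  have -> : ep p - h * g p.2 = z p.1 p.2 - y' p.2.
    by rewrite /ep /y' /next_y -/h /g; ring.
  move: (F01 (c p.1 p.2 - z p.1 p.2)) (hs p.1 p.2).
  set e := z p.1 p.2 - y' p.2; set Fz := F _; set Fy := F _; set sp := s _ _.
  move=> /andP[Fz0 Fz1] /andP[s0 s1] hF.
  have -> : z p.1 p.2 + k * (Fz - sp) - y' p.2 = e + k * (Fz - sp).
    by rewrite /e; ring.
  have hD : (Fz - sp) ^+ 2 <= 1 by nra.
  have hD' : k ^+ 2 * (Fz - sp) ^+ 2 <= k ^+ 2.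
    by rewrite ler_piMr ?sqr_ge0.
  have hF' : 2 * k * (e * (Fz - Fy)) <= 2 * k * (- f * e ^+ 2).
    by rewrite ler_pM2l // mulr_gt0.
  have -> : (e + k * (Fz - sp)) ^+ 2 = e ^+ 2 + 2 * k * (e * (Fz - Fy))
     + 2 * k * (e * (Fy - sp)) + k ^+ 2 * (Fz - sp) ^+ 2 by ring.
  have -> : (1 - 2 * k * f) * e ^+ 2 = e ^+ 2 + 2 * k * (- f * e ^+ 2) by ring.
  by apply: lerD => //; rewrite lerD2r lerD2l.
apply: le_trans step _.
rewrite !big_split /= (sumd (k ^+ 2)) -!mulr_sumr -/(innovation y' z s).
have -> : \sum_(p in edges adj) (ep p - h * g p.2) ^+ 2
    = estimation_error adj y z - 2 * h * S + h ^+ 2 * G2.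
  rewrite /S /G2 !mulr_sumr -sumrB -big_split /=.
  by apply: eq_bigr => p _; rewrite /ep; ring.
set U := estimation_error adj y z; set I := innovation _ _ _.
rewrite [leLHS]addrAC lerD2r.
have := estimation_drift lambda2_gt0 y z nG0.
rewrite -/nG -/nQW -/nQL -/alpha -/S -/U; set V := disagreement y => hS.
set B := (2 * M * N%:R) ^+ 2; set B' := 2 * M * (2 * M * N%:R).
have v0 : 0 < tau^-1 by rewrite invr_gt0.
have T1 : h * (- 2 * S) <= h * (alpha * U + nG ^+ 2 / lambda2 * V).
  by rewrite ler_pM2l.
have T2 : h ^+ 2 * G2 <= h ^+ 2 * (d * B) by rewrite ler_pM2l ?exprn_gt0.
(* [1 - 2 * k * f] may be negative, so the product is expanded: the mixed terms in [k] and [h] are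
   of order [1 / tau ^+ 2], as here, or of favourable sign, as in [T4]. *)
have T3 : 4 * k * f * h * S <= 4 * k * f * h * (d * B').
  by rewrite ler_pM2l ?mulr_gt0.
have T4 : 0 <= 2 * k * f * h ^+ 2 * G2.
  rewrite mulr_ge0 ?sumr_ge0 ?mulr_ge0 ?exprn_ge0 ?ltW // => p _.
  exact: sqr_ge0.
have -> : U + (gamma * nG ^+ 2 / lambda2 * V
     - (2 * beta * f - gamma * alpha) * U) / tau
   + (gamma ^+ 2 * (d * B) + 4 * beta * f * gamma * (d * B') + beta ^+ 2 * d)
     / tau ^+ 2
   = U + h * (alpha * U + nG ^+ 2 / lambda2 * V) - 2 * k * f * U
     + h ^+ 2 * (d * B) + 4 * k * f * h * (d * B') + d * k ^+ 2.
  by rewrite /h /k; field; rewrite !gt_eqF.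
have -> : (1 - 2 * k * f) * (U - 2 * h * S + h ^+ 2 * G2) + d * k ^+ 2
  = U + h * (- 2 * S) - 2 * k * f * U + h ^+ 2 * G2 + 4 * k * f * h * S
    - 2 * k * f * h ^+ 2 * G2 + d * k ^+ 2 by ring.
have aux (u t1 t1' t2 t2' t3 t3' t4 w e : R) : t1 <= t1' -> t2 <= t2' ->
    t3 <= t3' -> 0 <= t4 ->
  u + t1 - w + t2 + t3 - t4 + e <= u + t1' - w + t2' + t3' + e by lra.
exact: aux.
Qed.

Definition lyapunov (w1 w2 : R) (y : 'I_N -> R) (z : 'I_N -> 'I_N -> R) : R :=
  w1 * disagreement y + w2 * estimation_error adj y z.

(** The two weight conditions compare the coefficients of disagreement and of estimation error
    separately; their slacks are what remains at first order in [1 / tau]. *)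
Lemma lyapunov_next (w1 w2 mu : R) : 0 < w1 -> 0 < w2 ->
  w2 * (gamma * nG ^+ 2 / lambda2) <= w1 * (gamma * lambda2 - mu) ->
  w1 * (gamma * nG ^+ 2 / lambda2) <= w2 * (2 * beta * f - gamma * alpha - mu) ->
  exists2 C : R, 0 <= C & forall (tau : R) y z s, 0 < tau -> bounded_state y z ->
  (forall i, `|next_y tau y z i| <= M) -> (forall i j, 0 <= s i j <= 1) ->
  lyapunov w1 w2 (next_y tau y z) (next_z tau z s)
  <= (1 - mu / tau) * lyapunov w1 w2 y z + C / tau ^+ 2
     + w2 * (2 * (beta / tau)) * innovation (next_y tau y z) z s.
Proof.
move=> w10 w20 hw1 hw2.
pose C1 := gamma ^+ 2 * (N%:R * (2 * M * N%:R) ^+ 2).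
pose C2 := gamma ^+ 2 * (d * (2 * M * N%:R) ^+ 2)
        + 4 * beta * f * gamma * (d * (2 * M * (2 * M * N%:R)))
        + beta ^+ 2 * d.
have M0' := ltW M0; have b0' := ltW beta0; have g0' := ltW gamma0.
have f0' := ltW f0; have d0 : 0 <= d by rewrite ler0n.
exists (w1 * C1 + w2 * C2).
  by rewrite /C1 /C2 !(addr_ge0, mulr_ge0, exprn_ge0) // ltW.
move=> tau y z s tau0 hb hy' hs.
have h1 := disagreement_next tau0 hb.
have h2 := estimation_error_next tau0 hb hy' hs.
rewrite -/C1 in h1; rewrite -/C2 in h2.
move: (ler_wpM2l (ltW w10) h1) (ler_wpM2l (ltW w20) h2) => {h1 h2}.
rewrite /lyapunov; set V := disagreement y; set U := estimation_error adj y z.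
set I := innovation _ _ _; set V' := disagreement _.
set U' := estimation_error _ _ _ => h1 h2.
apply: le_trans (lerD h1 h2) _.
set r := gamma * nG ^+ 2 / lambda2 in hw1 hw2 *.
set p1 := gamma * lambda2 in hw1 *.
set p2 := 2 * beta * f - gamma * alpha in hw2 *.
have V0 : 0 <= V by apply: sumr_ge0 => i _; exact: sqr_ge0.
have U0 : 0 <= U by apply: sumr_ge0 => i _; exact: sqr_ge0.
rewrite -subr_ge0.
have -> : (1 - mu / tau) * (w1 * V + w2 * U) + (w1 * C1 + w2 * C2) / tau ^+ 2
   + w2 * (2 * (beta / tau)) * I
   - (w1 * (V + (r * U - p1 * V) / tau + C1 / tau ^+ 2)
      + w2 * (U + (r * V - p2 * U) / tau + C2 / tau ^+ 2
              + 2 * (beta / tau) * I))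
  = ((w1 * (p1 - mu) - w2 * r) * V + (w2 * (p2 - mu) - w1 * r) * U) / tau.
  by ring.
by rewrite divr_ge0 ?addr_ge0 ?mulr_ge0 ?subr_ge0 // ltW.
Qed.

End LyapunovStep.

(** * Expectations in the reals *)

Section RealExpectation.
Variables (R : realType) (dT : measure_display) (T : measurableType dT).
Variable P : probability T R.

Definition integrable_rv (X : T -> R) := P.-integrable setT (EFin \o X).
Definition Ex (X : T -> R) : R := (\int[P]_w X w)%R.

Lemma expectation_Ex (X : T -> R) : integrable_rv X -> ('E_P[X] = (Ex X)%:E)%E.
Proof.
by move=> iX; rewrite unlock /Ex /Rintegral fineK // integrable_fin_num.
Qed.

Lemma integrable_rv_cst (r : R) : integrable_rv (fun=> r).
Proof. exact: finite_measure_integrable_cst. Qed.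

Lemma integrable_rv_indic (D : set T) : measurable D -> integrable_rv \1_D.
Proof. by move=> mD; apply: integrable_indic. Qed.

Lemma integrable_rvZ (r : R) (X : T -> R) :
  integrable_rv X -> integrable_rv (fun w => r * X w).
Proof. by move=> iX; apply: (integrableZl measurableT r iX). Qed.

Lemma integrable_rvD (X Y : T -> R) :
  integrable_rv X -> integrable_rv Y -> integrable_rv (fun w => X w + Y w).
Proof. by move=> iX iY; apply: (integrableD measurableT iX iY). Qed.

Lemma integrable_rv_sum (I : Type) (s : seq I) (Q : pred I) (X : I -> T -> R) :
  (forall i, Q i -> integrable_rv (X i)) ->
  integrable_rv (fun w => \sum_(i <- s | Q i) X i w).
Proof.
move=> iX; elim: s => [|i s IH].
  have -> : (fun w => \sum_(i <- [::] | Q i) X i w) = (fun=> 0).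
    by apply/funext => w; rewrite big_nil.
  exact: integrable_rv_cst.
have [Qi|Qi] := boolP (Q i).
  have -> : (fun w => \sum_(j <- i :: s | Q j) X j w)
     = (fun w => X i w + \sum_(j <- s | Q j) X j w).
    by apply/funext => w; rewrite big_cons Qi.
  by apply: integrable_rvD => //; exact: iX.
have -> // : (fun w => \sum_(j <- i :: s | Q j) X j w)
   = (fun w => \sum_(j <- s | Q j) X j w).
by apply/funext => w; rewrite big_cons (negbTE Qi).
Qed.

Lemma Ex_cst (r : R) : Ex (fun=> r) = r.
Proof.
rewrite /Ex Rintegral_cst // -[RHS]mulr1; congr (_ * _).
by rewrite -[RHS]/(fine 1%E); congr fine; exact: probability_setT.
Qed.

Lemma ExZ (r : R) (X : T -> R) :
  integrable_rv X -> Ex (fun w => r * X w) = r * Ex X.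
Proof. by move=> iX; rewrite /Ex RintegralZl. Qed.

Lemma ExD (X Y : T -> R) : integrable_rv X -> integrable_rv Y ->
  Ex (fun w => X w + Y w) = Ex X + Ex Y.
Proof. by move=> iX iY; rewrite /Ex RintegralD. Qed.

Lemma Ex_sum (I : Type) (s : seq I) (Q : pred I) (X : I -> T -> R) :
  (forall i, Q i -> integrable_rv (X i)) ->
  Ex (fun w => \sum_(i <- s | Q i) X i w) = \sum_(i <- s | Q i) Ex (X i).
Proof.
move=> iX; elim: s => [|i s IH].
  rewrite big_nil -[RHS]Ex_cst; congr Ex; apply/funext => w.
  by rewrite big_nil.
rewrite big_cons; have [Qi|Qi] := boolP (Q i).
  rewrite -IH -ExD //; [|exact: iX|exact: integrable_rv_sum].
  by congr Ex; apply/funext => w; rewrite big_cons Qi.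
by rewrite -IH; congr Ex; apply/funext => w; rewrite big_cons (negbTE Qi).
Qed.

Lemma Ex_indic (D : set T) : measurable D -> Ex \1_D = fine (P D).
Proof. by move=> mD; rewrite /Ex /Rintegral integral_indic // setIT. Qed.

Lemma le_Ex (X Y : T -> R) : integrable_rv X -> integrable_rv Y ->
  (forall w, X w <= Y w) -> Ex X <= Ex Y.
Proof. by move=> iX iY XY; apply: le_Rintegral => // w _. Qed.

End RealExpectation.

(** * Noise events before a given time *)

Section Cylinders.
Variables (R : realType) (dT : measure_display) (T : measurableType dT).
Variables (P : probability T R) (J : eqType) (D : set (J * nat)).
Variable X : J * nat -> T -> R.
Hypothesis Xmeas : forall q, D q -> measurable_fun setT (X q).
Hypothesis Xindep : mutually_independent P D X.

(** Finite rectangles stand in for the past sigma-algebra: mutual independence applies to them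
    directly, and they are stable under adding constraints at time [t]. *)
Definition cylinder (t : nat) (A : set T) := exists (s : seq (J * nat)) B,
  [/\ uniq s, (forall q, q \in s -> D q /\ (q.2 < t)%N),
      (forall q, measurable (B q : set R)) &
      A = \big[setI/setT]_(q <- s) (X q @^-1` B q)].

Lemma cylinder_measurable t A : cylinder t A -> measurable A.
Proof.
move=> [s [B [us sD mB ->]]]; rewrite big_seq.
apply: bigsetI_measurable => q /sD[Dq _].
by rewrite -[X in measurable X]setTI; apply: Xmeas.
Qed.

Lemma cylinder_indep t A q B : cylinder t A -> D q -> (t <= q.2)%N ->
  measurable B ->
  fine (P (A `&` (X q @^-1` B))) = fine (P A) * fine (P (X q @^-1` B)).
Proof.
move=> [s [Bs [us sD mBs ->]]] Dq tq mB.
have qs : q \notin s.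
  by apply/negP => /sD[_]; rewrite ltnNge tq.
(* [q] is not in [s], as its time is at least [t]; overriding [Bs] at [q] lets independence be used
   on the single list [q :: s]. *)
pose B' r := if r == q then B else Bs r.
have mB' r : measurable (B' r) by rewrite /B'; case: ifP.
have eqs (F : (J * nat) -> set R -> set T) :
   \big[setI/setT]_(r <- s) F r (Bs r) = \big[setI/setT]_(r <- s) F r (B' r).
  rewrite !big_seq; apply: eq_bigr => r rs; rewrite /B'; case: eqP => // rq.
  by rewrite rq (negbTE qs) in rs.
rewrite (Xindep us (fun r rs => (sD r rs).1) mBs).
have := @Xindep (q :: s) B' _ _ mB'; rewrite !big_cons /= qs us.
rewrite {1 2}/B' eqxx setIC (eqs (fun r C => X r @^-1` C)) => -> //.
  rewrite mulrC {2}/B' eqxx; congr (_ * _); rewrite !big_seq.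
  apply: eq_bigr => r rs.
  by rewrite /B'; case: eqP => // rq; rewrite rq (negbTE qs) in rs.
by move=> r; rewrite inE => /predU1P[->|/sD[]].
Qed.

Lemma cylinder_setT t : cylinder t setT.
Proof.
by exists [::], (fun=> setT); split => //; rewrite big_nil.
Qed.

Lemma cylinder_extend t A (l : seq J) (C : J -> set R) :
  cylinder t A -> uniq l -> (forall p, p \in l -> D (p, t)) ->
  (forall p, measurable (C p)) ->
  cylinder t.+1 (A `&` \big[setI/setT]_(p <- l) (X (p, t) @^-1` C p)).
Proof.
move=> [s [B [us sD mB ->]]] ul lD mC.
exists (s ++ [seq (p, t) | p <- l]), (fun q => if q.2 == t then C q.1 else B q).
split.
- rewrite cat_uniq us /= map_inj_uniq ?ul ?andbT; last by move=> ? ? [].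
  by apply/hasPn => _ /mapP[p _ ->]; apply/negP => /sD[_]; rewrite ltnn.
- move=> q; rewrite mem_cat => /orP[/sD[Dq qt]|/mapP[p pl ->]].
    by split => //; apply: ltnW.
  by split => //; exact: lD.
- by move=> q; case: ifP.
rewrite big_cat big_map /=; congr (_ `&` _).
  rewrite !big_seq; apply: eq_bigr => q /sD[_ qt].
  by rewrite ltn_eqF.
by apply: eq_bigr => p _; rewrite eqxx.
Qed.

End Cylinders.

(** * Bit histories *)

Section Histories.
Variables (R : realType) (N : nat) (adj : rel 'I_N).
Variables (c : 'I_N -> 'I_N -> R) (F : R -> R) (beta gamma M : R) (t0 : nat).
Variables (y0 : 'I_N -> R) (z0 : 'I_N -> 'I_N -> R).
Variables (dT : measure_display) (T : measurableType dT) (P : probability T R).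
Variable noise : 'I_N -> 'I_N -> nat -> T -> R.
Hypothesis noise_meas : forall i j t, adj i j ->
  measurable_fun setT (noise i j t).
Hypothesis noise_indep : mutually_independent P
  [set p : 'I_N * 'I_N * nat | adj p.1.1 p.1.2]
  (fun p => noise p.1.1 p.1.2 p.2).
Hypothesis noise_cdf : forall i j t x, adj i j ->
  fine (P (noise i j t @^-1` [set v | v <= x])) = F x.

Definition bits := {ffun 'I_N * 'I_N -> bool}.

(* A history lists the bits received so far, latest first; the component [.1]
   after [k] bits is [K2 x(t0 + 1 + k)] and [.2] is the estimate at [t0 + k]. *)
Fixpoint hstate (h : seq bits) : ('I_N -> R) * ('I_N -> 'I_N -> R) :=
  if h is b :: h' then
    let t := (t0 + 1 + size h')%N in
    let z' := next_z c F beta M t%:R (hstate h').2 (fun i j => (b (i, j))%:R) in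
    (next_y adj gamma (t + 1)%:R (hstate h').1 z', z')
  else (y0, z0).

(** Bits off the edges are fixed to false, so that a history constrains only the noises assumed
    measurable and independent. *)
Definition new_bits (h : seq bits) (k : nat) (w : T) : bits :=
  [ffun p => adj p.1 p.2 &&
     ((hstate h).1 p.2 + noise p.1 p.2 (t0 + 1 + k)%N w <= c p.1 p.2)].

Fixpoint hist (k : nat) (w : T) : seq bits :=
  if k is k'.+1 then new_bits (hist k' w) k' w :: hist k' w else [::].

Lemma size_hist k w : size (hist k w) = k.
Proof. by elim: k => //= k ->. Qed.

Definition hevent (k : nat) (h : seq bits) : set T := [set w | hist k w = h].

Let D := [set p : 'I_N * 'I_N * nat | adj p.1.1 p.1.2].
Let X (p : 'I_N * 'I_N * nat) := noise p.1.1 p.1.2 p.2.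

Let Xmeas q : D q -> measurable_fun setT (X q).
Proof. exact: noise_meas. Qed.

Definition bit_set (a x : R) (b : bool) : set R := [set v | (a + v <= x) = b].

Lemma bit_set_true (a x : R) : bit_set a x true = [set v | v <= x - a].
Proof. by apply/seteqP; split => v /=; rewrite /bit_set /= lerBrDl. Qed.

Lemma bit_set_measurable (a x : R) (b : bool) : measurable (bit_set a x b).
Proof.
case: b; first by rewrite bit_set_true; exact: half_line_measurable.
have -> : bit_set a x false = ~` [set v | v <= x - a].
  apply/seteqP; split => v; rewrite /bit_set /= lerBrDl; first by move=> ->.
  by move/negP/negbTE.
by apply: measurableC; exact: half_line_measurable.
Qed.

(* Given the past, the bits are noise events, so fixing a whole history amounts
   to restricting finitely many independent noises to deterministic sets. *)
Lemma hevent_cylinder k h :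
  hevent k h = set0 \/ cylinder D X (t0 + 1 + k) (hevent k h).
Proof.
elim: k h => [|k IH] h.
  case: h => [|b h]; last by left; apply/seteqP; split.
  right; have -> : hevent 0 [::] = setT by apply/seteqP; split.
  exact: cylinder_setT.
case: h => [|b h]; first by left; apply/seteqP; split.
have hE : hevent k.+1 (b :: h) = hevent k h `&` [set w | new_bits h k w = b].
  apply/seteqP; split => w /=; rewrite /hevent /=; first by move=> [<- ->].
  by move=> [-> ->].
have [h0|hcyl] := IH h; first by left; rewrite hE h0 set0I.
have [bval|] := pselect (forall p, ~~ adj p.1 p.2 -> b p = false); last first.
  move=> nb; left; rewrite hE; apply/seteqP; split => // w [_ /= eb].
  apply: nb => p /negbTE np; by rewrite -eb ffunE np.
right; rewrite addnS hE.
have -> : [set w | new_bits h k w = b]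
   = \big[setI/setT]_(p <- enum (edges adj))
       (X (p, (t0 + 1 + k)%N) @^-1` bit_set ((hstate h).1 p.2) (c p.1 p.2) (b p)).
  rewrite -bigcap_seq; apply/seteqP; split => w /=.
    move=> <- p /=; rewrite mem_enum inE /bit_set /= => ap.
    by rewrite ffunE ap.
  move=> hw; apply/ffunP => p; rewrite ffunE.
  have [ap|np] := boolP (adj p.1 p.2); last by rewrite bval.
  by apply: (hw p); rewrite /= mem_enum inE.
apply: cylinder_extend => //; first exact: enum_uniq.
  by move=> p; rewrite mem_enum inE.
by move=> p; exact: bit_set_measurable.
Qed.

Lemma hevent_measurable k h : measurable (hevent k h).
Proof. by have [->//|/(cylinder_measurable Xmeas)] := hevent_cylinder k h. Qed.

(** An arbitrary function of the history is a finite combination of indicators, so no regularity of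
    [g] has to be tracked. *)
Lemma hist_decomp k (g : seq bits -> R) w :
  g (hist k w) = \sum_(h : k.-tuple bits) g h * \1_(hevent k h) w.
Proof.
pose hw := Tuple (introT eqP (size_hist k w)).
rewrite (bigD1 hw) //= [X in _ = _ + X]big1 ?addr0.
  by rewrite indicE mem_set ?mulr1.
move=> h hn; rewrite indicE memNset ?mulr0 // => e.
by move/eqP: hn; apply; apply: val_inj.
Qed.

Lemma integrable_hist k (g : seq bits -> R) :
  integrable_rv P (fun w => g (hist k w)).
Proof.
have -> : (fun w => g (hist k w))
   = (fun w => \sum_(h : k.-tuple bits) g h * \1_(hevent k h) w).
  by apply/funext => w; exact: hist_decomp.
apply: integrable_rv_sum => h _; apply: integrable_rvZ.
by apply: integrable_rv_indic; exact: hevent_measurable.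
Qed.

(** On each history the output is a constant y, and the bit is 1 on the independent event that the
    noise is at most c - y, of probability F(c - y). *)
Lemma innovation_mean0 k (g : seq bits -> R) i j : adj i j ->
  Ex P (fun w => g (hist k w) *
    (F (c i j - (hstate (hist k w)).1 j) - (new_bits (hist k w) k w (i, j))%:R))
  = 0.
Proof.
move=> aij; pose A h := noise i j (t0 + 1 + k)%N @^-1`
  bit_set ((hstate h).1 j) (c i j) true.
have mA h : measurable (A h).
  rewrite -[X in measurable X]setTI; apply: noise_meas => //.
  exact: bit_set_measurable.
have mE h := hevent_measurable k h.
pose Fh h := F (c i j - (hstate h).1 j).
have -> : (fun w => g (hist k w) *
    (F (c i j - (hstate (hist k w)).1 j) - (new_bits (hist k w) k w (i, j))%:R))
  = (fun w => \sum_(h : k.-tuple bits) (g h * Fh h * \1_(hevent k h) w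
       + - g h * \1_(hevent k h `&` A h) w)).
  apply/funext => w; pose b h : R := (new_bits h k w (i, j))%:R.
  rewrite (hist_decomp k (fun h => g h * (Fh h - b h))); apply: eq_bigr => h _.
  have -> : b h = \1_(A h) w.
    rewrite /b ffunE aij indicE; congr ((nat_of_bool _)%:R).
    by apply/esym; apply/idP/idP; rewrite in_setE.
  by rewrite indicI /=; ring.
rewrite Ex_sum; last first.
  move=> h _; apply: integrable_rvD; apply: integrable_rvZ;
    apply: integrable_rv_indic => //; exact: measurableI.
apply: big1 => h _; rewrite ExD; first last.
- by apply: integrable_rvZ; apply: integrable_rv_indic; exact: measurableI.
- by apply: integrable_rvZ; exact: integrable_rv_indic.
rewrite !ExZ ?Ex_indic //; try exact: integrable_rv_indic;
  try exact: measurableI.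
  have [->|hcyl] := hevent_cylinder k h.
    by rewrite set0I measure0 !mulr0 addr0.
  have := @cylinder_indep _ _ _ P _ D X noise_indep _ _ (i, j, (t0 + 1 + k)%N)
    _ hcyl aij (leqnn _) (bit_set_measurable ((hstate h).1 j) (c i j) true).
  rewrite -/(A h) /X /= -/(A h) => ->.
  by rewrite /A bit_set_true noise_cdf // -/(Fh h); ring.
by apply: integrable_rv_indic; exact: measurableI.
Qed.

End Histories.

(** * Reduction to scalar outputs and choice of weights *)

Lemma closed_loop_K2 (R : realType) (n : nat) (a : 'I_n -> R) (b : nat -> R)
    (x : 'cV[R]_n) (v : R) : (0 < n)%N ->
  rdot (K2mat n b) (Amat a *m x + (rdot (K1mat a b) x + v) *: Bvec R n)
  = rdot (K2mat n b) x + v.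
Proof.
case: n a x => // n a x _; set K2 := K2mat _ _; set K1 := K1mat _ _.
have K2B : K2 *m Bvec R n.+1 = 1%:M.
  apply/matrixP => i j; rewrite !ord1 !mxE eqxx /= (bigD1 ord_max) //=.
  rewrite big1 ?addr0 => [|k kn]; first by rewrite !mxE /K2ent /= ltnn eqxx mulr1.
  rewrite !mxE eqSS; case: eqP => [kE|]; last by rewrite mulr0.
  by move/eqP: kn; case; apply: val_inj.
(* [K1mat] is K2 - K2 A written out: column j of K2 A is a_j, from the last row of A, plus the
   preceding entry of K2, from its superdiagonal. *)
have K2A : K2 *m Amat a + K1 = K2.
  apply/rowP => j; rewrite !mxE.
  rewrite (bigD1 ord_max) //= !mxE eqxx /K2ent /= ltnn mul1r.
  rewrite (eq_bigr (fun i : 'I_n.+1 => if (j : nat) == i.+1 then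
      (if (i < n)%N then b i else 1) else 0)) => [|i iN]; last first.
    rewrite !mxE eqSS /K2ent /=; case: (_ =P n) => [kE|_].
      by move/eqP: iN; case; apply: val_inj.
    by case: eqP; rewrite ?mulr1 ?mulr0.
  have -> : \sum_(i < n.+1 | i != ord_max)
       (if (j : nat) == i.+1 then if (i < n)%N then b i else 1 else 0)
     = if (j : nat) == 0%N then 0 else if (j.-1 < n)%N then b j.-1 else 1.
    have [j0|jn0] := eqVneq (j : nat) 0%N.
      by apply: big1 => i _; rewrite j0.
    have jn : (j.-1 < n.+1)%N by rewrite prednK ?lt0n // ltnW.
    rewrite (bigD1 (Ordinal jn)) /=; last first.
      apply/eqP => /(congr1 val) /= e.
      by have := ltn_ord j; rewrite -[val j]prednK ?lt0n // e ltnn.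
    rewrite prednK ?lt0n // eqxx big1 ?addr0 // => i /andP[_ ij].
    case: eqP => // je; move/eqP: ij; case; apply: val_inj => /=.
    by rewrite je.
  have aux (p q w : R) : p + q + (- p + w - q) = w by ring.
  exact: aux.
rewrite /rdot mulmxDr -scalemxAr K2B mulmxA [LHS]mxE [X in _ + X]mxE.
have -> : (1%:M : 'M[R]_1) 0 0 = 1 by rewrite mxE.
rewrite mulr1 addrA; congr (_ + _).
by rewrite -[in RHS]K2A mulmxDl [RHS]mxE.
Qed.

Lemma rdot_mean (R : realType) (n N : nat) (K : 'rV[R]_n)
    (x : 'I_N -> 'cV[R]_n) :
  rdot K (N%:R^-1 *: \sum_i x i) = mean (fun i => rdot K (x i)).
Proof.
rewrite /rdot -scalemxAr mxE /mean; congr (_ * _).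
by rewrite mulmx_sumr summxE.
Qed.

Lemma connected_edge (N : nat) (adj : rel 'I_N) : (1 < N)%N ->
  (forall i j, connect adj i j) -> exists i j, adj i j.
Proof.
move=> N2 hc; have := hc (Ordinal (ltnW N2)) (Ordinal N2).
move=> /connectP[[|j p] /=]; first by move=> _ /(congr1 val).
by move=> /andP[h _] _; exists (Ordinal (ltnW N2)), j.
Qed.

(** On the basis vector of an edge leaving [i], J_N W has i-th entry 1 - 1/N, which is nonzero. *)
Lemma specnorm_JW_gt0 (R : realType) (N : nat) (adj : rel 'I_N) :
  (1 < N)%N -> (forall i j, connect adj i j) ->
  0 < specnorm (Jmat R N *m Wmat R adj).
Proof.
move=> N2 hc; have [i [j aij]] := connected_edge N2 hc.
rewrite lt_def specnorm_ge0 andbT; apply/eqP => n0.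
have eE : (i, j) \in edges adj by rewrite inE.
pose p := enum_rank_in eE (i, j).
have := vnorm_mulmx_le (Jmat R N *m Wmat R adj) (delta_mx p 0).
rewrite n0 mul0r => h.
have /vnorm_eq0 h0 : vnorm (Jmat R N *m Wmat R adj *m delta_mx p 0) = 0.
  by apply/le_anti; rewrite h vnorm_ge0.
have /colP/(_ i) := h0; rewrite -mulmxA -colE !mxE (bigD1 i) //= big1.
  rewrite !mxE eqxx enum_rankK_in // eqxx mulr1 addr0 mulr1 => /eqP.
  rewrite subr_eq0 eq_sym invr_eq1 => /eqP N1.
  by have := N2; rewrite -(ltr_nat R) N1 ltxx.
move=> k ki; rewrite !mxE enum_rankK_in //= eq_sym (negbTE ki) mulr0 //.
Qed.

Lemma lyapunov_weights (R : realType) (p1 p2 r mu0 : R) : 0 < r ->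
  mu0 < p1 -> r ^+ 2 < (p1 - mu0) * (p2 - mu0) ->
  exists w1 w2 mu : R, [/\ 0 < w1, 0 < w2, mu0 < mu,
    w2 * r <= w1 * (p1 - mu) & w1 * r <= w2 * (p2 - mu)].
Proof.
move=> r0 h1; rewrite -subr_gt0 in h1; move: h1.
move P1E : (p1 - mu0) => P1; move P2E : (p2 - mu0) => P2 P10 hr.
have P20 : 0 < P2.
  by rewrite -(pmulr_rgt0 _ P10) (le_lt_trans _ hr) ?sqr_ge0.
(* Determinant over trace of the symmetric matrix with diagonal [P1], [P2] and off-diagonal [- r]: a
   rational lower bound for its least eigenvalue, with [(P1 - eta) * (P2 - eta) = r ^+ 2 + eta ^+
   2]. The weights [P2 - eta] and [r] make the last inequality an equality. *)
pose eta := (P1 * P2 - r ^+ 2) / (P1 + P2).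
have s0 : 0 < P1 + P2 by rewrite addr_gt0.
have eta0 : 0 < eta by rewrite divr_gt0 ?subr_gt0.
have etaE : eta * (P1 + P2) = P1 * P2 - r ^+ 2 by rewrite mulfVK ?gt_eqF.
have etaP : eta < P2.
  rewrite ltr_pdivrMr // mulrDr.
  have : 0 < r ^+ 2 by rewrite exprn_gt0.
  have : 0 <= P2 * P2 by rewrite mulr_ge0 ?ltW.
  by rewrite (mulrC P2 P1); lra.
exists (P2 - eta), r, (mu0 + eta); split => //.
- by rewrite subr_gt0.
- by rewrite ltrDl.
- have -> : p1 - (mu0 + eta) = P1 - eta by rewrite -P1E; ring.
  have -> : (P2 - eta) * (P1 - eta) = P1 * P2 - eta * (P1 + P2) + eta ^+ 2.
    by ring.
  by rewrite etaE opprB addrCA subrr addr0 -expr2 lerDl sqr_ge0.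
have -> : p2 - (mu0 + eta) = P2 - eta by rewrite -P2E; ring.
by rewrite mulrC.
Qed.

(** * Mean-square recursion *)

Section MeanSquare.
Variables (R : realType) (N : nat) (adj : rel 'I_N).
Hypothesis N0 : (0 < N)%N.
Variable lambda2 : R.
Hypothesis lambda2_gt0 : 0 < lambda2.
Hypothesis gap : forall y, \sum_i y i = 0 ->
  lambda2 * (\sum_i y i ^+ 2) <= \sum_i \sum_j y i * laplacian R adj i j * y j.
Variables (c : 'I_N -> 'I_N -> R) (F : R -> R) (beta gamma M f : R).
Hypotheses (beta0 : 0 < beta) (gamma0 : 0 < gamma) (M0 : 0 < M) (f0 : 0 < f).
Hypothesis F01 : forall x, 0 <= F x <= 1.
Hypothesis Fmono : forall i j (a b : R), adj i j -> `|a| <= M -> `|b| <= M ->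
  (a - b) * (F (c i j - a) - F (c i j - b)) <= - f * (a - b) ^+ 2.
Let nG := specnorm (Jmat R N *m Wmat R adj).
Let nQW := specnorm (Qmat R adj *m Wmat R adj).
Let nQL := specnorm (Qmat R adj *m laplacian R adj).
Hypothesis nG0 : 0 < nG.
Let alpha := 2 * nQW + nQL ^+ 2 * lambda2 / nG ^+ 2.
Variables (t0 : nat) (y0 : 'I_N -> R) (z0 : 'I_N -> 'I_N -> R).
Hypothesis ht0 : gamma * (dmax adj)%:R - 1 < t0%:R.
Hypothesis init_bounded : bounded_state adj M y0 z0.
Variables (dT : measure_display) (T : measurableType dT) (P : probability T R).
Variable noise : 'I_N -> 'I_N -> nat -> T -> R.
Hypothesis noise_meas : forall i j t, adj i j ->
  measurable_fun setT (noise i j t).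
Hypothesis noise_indep : mutually_independent P
  [set p : 'I_N * 'I_N * nat | adj p.1.1 p.1.2]
  (fun p => noise p.1.1 p.1.2 p.2).
Hypothesis noise_cdf : forall i j t x, adj i j ->
  fine (P (noise i j t @^-1` [set v | v <= x])) = F x.

Local Notation hs := (hstate adj c F beta gamma M t0 y0 z0).
Local Notation hi := (hist adj c F beta gamma M t0 y0 z0 noise).
Local Notation nb := (new_bits adj c F beta gamma M t0 y0 z0 noise).
Let intg k g : integrable_rv P (fun w => g (hi k w)) :=
  integrable_hist c F beta gamma M t0 y0 z0 P noise_meas k g.

Lemma hstate_bounded h : bounded_state adj M (hs h).1 (hs h).2.
Proof.
elim: h => [//|b h [hy hz]].
have hz' i j : `|(hs (b :: h)).2 i j| <= M by exact: projM_norm.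
split=> [i|i j _]; last exact: hz'.
have htau m : gamma * (dmax adj)%:R <= (t0 + 1 + m + 1)%:R.
  have := ht0; rewrite ltrBlDr => h1; apply: ltW; apply: (lt_le_trans h1).
  by rewrite natr1 ler_nat -!addnA -addn1 leq_add2l addnA leq_addl.
apply: next_y_bound => //.
by split=> [|k l _]; [exact: hy | exact: hz'].
Qed.

Lemma half_step_bounded h : bounded_state adj M (hs (behead h)).1 (hs h).2.
Proof.
by split; [exact: (hstate_bounded _).1 | exact: (hstate_bounded _).2].
Qed.

(** [behead] undoes the lag inside [hstate]: for [h] of length [k.+1], both the output and the
    estimate are taken at time [t0 + 1 + k]. *)
Definition hlyapunov w1 w2 h : R :=
  lyapunov adj w1 w2 (hs (behead h)).1 (hs h).2.

Definition mean_lyapunov w1 w2 k : R :=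
  Ex P (fun w => hlyapunov w1 w2 (hi k.+1 w)).

Let innov k w : R := innovation adj c F (hs (hi k w)).1 (hs (hi k w)).2
  (fun i j => (nb (hi k w) k w (i, j))%:R).

Let innov_integrable k : integrable_rv P (innov k).
Proof.
(* The latest bits are the head of the history; the default [b0] is never read, since the history
   has length [k.+1]. *)
pose b0 : bits N := [ffun=> false].
pose g h := innovation adj c F (hs (behead h)).1 (hs (behead h)).2
  (fun i j => (head b0 h (i, j))%:R).
exact: (intg k.+1 g).
Qed.

Let innov_mean0 k : Ex P (innov k) = 0.
Proof.
rewrite /innov /innovation Ex_sum => [|p _]; last first.
  pose b0 : bits N := [ffun=> false].
  pose g h := ((hs (behead h)).2 p.1 p.2 - (hs (behead h)).1 p.2)
    * (F (c p.1 p.2 - (hs (behead h)).1 p.2) - (head b0 h (p.1, p.2))%:R).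
  exact: (intg k.+1 g).
apply: big1 => p; rewrite inE => ap.
exact: (innovation_mean0 c beta gamma M t0 y0 z0 noise_meas noise_indep
  noise_cdf k (fun h => (hs h).2 p.1 p.2 - (hs h).1 p.2) ap).
Qed.

Lemma mean_lyapunov_recursion (w1 w2 mu : R) : 0 < w1 -> 0 < w2 ->
  w2 * (gamma * nG ^+ 2 / lambda2) <= w1 * (gamma * lambda2 - mu) ->
  w1 * (gamma * nG ^+ 2 / lambda2) <= w2 * (2 * beta * f - gamma * alpha - mu) ->
  exists2 C : R, 0 <= C & forall k, mean_lyapunov w1 w2 k.+1
    <= (1 - mu / (t0 + 1 + k).+1%:R) * mean_lyapunov w1 w2 k
       + C / (t0 + 1 + k).+1%:R ^+ 2.
Proof.
move=> w10 w20 hw1 hw2.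
have [C C0 step] := lyapunov_next N0 lambda2_gt0 gap beta0 gamma0 M0 f0 F01
  Fmono nG0 w10 w20 hw1 hw2.
exists C => // k; set tau : R := (t0 + 1 + k).+1%:R.
have tau0 : 0 < tau by rewrite ltr0Sn.
have pathwise w : hlyapunov w1 w2 (hi k.+2 w)
    <= (1 - mu / tau) * hlyapunov w1 w2 (hi k.+1 w) + C / tau ^+ 2
       + w2 * (2 * (beta / tau)) * innov k.+1 w.
  pose h := hi k w; pose h1 := hi k.+1 w.
  (* The output step that ends round [k] and the estimate step of the following round share the
     denominator [tau]. *)
  have yE : (hs h1).1 = next_y adj gamma tau (hs h).1 (hs h1).2.
    by rewrite /h1 /= size_hist addn1.
  have zE : (hs (hi k.+2 w)).2 = next_z c F beta M tau (hs h1).2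
      (fun i j => (nb h1 k.+1 w (i, j))%:R).
    by rewrite /= size_hist addnS.
  have := step tau (hs h).1 (hs h1).2 (fun i j => (nb h1 k.+1 w (i, j))%:R)
    tau0 (half_step_bounded h1).
  rewrite -yE -zE; apply.
    exact: (hstate_bounded h1).1.
  by move=> i j; case: (nb _ _ _ _); rewrite ?lexx ler01.
rewrite /mean_lyapunov.
have i1 := intg k.+1 (hlyapunov w1 w2).
have i2 := integrable_rvZ (1 - mu / tau) i1.
have i3 := integrable_rv_cst P (C / tau ^+ 2).
have i4 := integrable_rvZ (w2 * (2 * (beta / tau))) (innov_integrable k.+1).
have i23 := integrable_rvD i2 i3.
apply: le_trans (le_Ex (intg k.+2 _) (integrable_rvD i23 i4) pathwise) _.
rewrite ExD // ExD // Ex_cst ExZ // ExZ; last exact: innov_integrable.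
by rewrite innov_mean0 mulr0 addr0.
Qed.

Lemma disagreement_ge0 (y : 'I_N -> R) : 0 <= disagreement y.
Proof. exact: sum_sqr_ge0. Qed.

Lemma estimation_error_ge0 (y : 'I_N -> R) (z : 'I_N -> 'I_N -> R) :
  0 <= estimation_error adj y z.
Proof. by apply: sumr_ge0 => p _; exact: sqr_ge0. Qed.

Lemma mean_lyapunov_bounded (w1 w2 : R) : 0 < w1 -> 0 < w2 ->
  exists B : R, forall k, 0 <= mean_lyapunov w1 w2 k <= B.
Proof.
move=> w10 w20.
pose B := w1 * (N%:R * M ^+ 2) + w2 * (#|edges adj|%:R * (2 * M) ^+ 2).
exists B => k; apply/andP; split.
  rewrite /mean_lyapunov -(Ex_cst P 0); apply: le_Ex => [||w].
  - exact: integrable_rv_cst.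
  - exact: (intg k.+1 (hlyapunov w1 w2)).
  apply: addr_ge0; apply: mulr_ge0; rewrite ?(ltW w10) ?(ltW w20) //.
    exact: disagreement_ge0.
  exact: estimation_error_ge0.
rewrite /mean_lyapunov -(Ex_cst P B); apply: le_Ex => [||w].
- exact: (intg k.+1 (hlyapunov w1 w2)).
- exact: integrable_rv_cst.
have [hy hz] := half_step_bounded (hi k.+1 w).
rewrite /hlyapunov; set y := (hs _).1 in hy *; set z := (hs _).2 in hz *.
apply: lerD; apply: ler_wpM2l; rewrite ?(ltW w10) ?(ltW w20) //.
  apply: le_trans (disagreement_le N0 _) _.
  apply: (@le_trans _ _ (\sum_(i < N) M ^+ 2)); last first.
    by rewrite sumr_const card_ord [leRHS]mulr_natl.
  apply: ler_sum => i _; rewrite -real_normK ?num_real //.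
  by rewrite ler_pXn2r ?nnegrE // ltW.
rewrite mulr_natl -sumr_const; apply: ler_sum => p; rewrite inE => ap.
have hn : `|z p.1 p.2 - y p.2| <= 2 * M.
  apply: le_trans (ler_normB _ _) _; have := hz _ _ ap; have := hy p.2; lra.
rewrite -real_normK ?num_real //; apply: lerXn2r => //.
by rewrite nnegrE mulr_ge0 // ltW.
Qed.

Lemma integrable_disagreement k i : integrable_rv P
  (fun w => ((hs (hi k w)).1 i - mean (hs (hi k w)).1) ^+ 2).
Proof. exact: (intg k (fun h => ((hs h).1 i - mean (hs h).1) ^+ 2)). Qed.

Lemma integrable_estimation_error k i j : integrable_rv P
  (fun w => ((hs (hi k.+1 w)).2 i j - (hs (hi k w)).1 j) ^+ 2).
Proof.
exact: (intg k.+1 (fun h => ((hs h).2 i j - (hs (behead h)).1 j) ^+ 2)).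
Qed.

Lemma disagreement_le_mean_lyapunov (w1 w2 : R) k i : 0 < w1 -> 0 < w2 ->
  Ex P (fun w => ((hs (hi k w)).1 i - mean (hs (hi k w)).1) ^+ 2)
  <= mean_lyapunov w1 w2 k / w1.
Proof.
move=> w10 w20; rewrite ler_pdivlMr // mulrC -ExZ; last first.
  exact: integrable_disagreement.
apply: le_Ex => [||w].
- by apply: integrable_rvZ; exact: integrable_disagreement.
- exact: (intg k.+1 (hlyapunov w1 w2)).
rewrite /hlyapunov /lyapunov -[leLHS]addr0; apply: lerD.
  apply: ler_wpM2l; first exact: ltW.
  rewrite /disagreement (bigD1 i) //= lerDl sumr_ge0 // => j _.
  exact: sqr_ge0.
by apply: mulr_ge0; [exact: ltW | exact: estimation_error_ge0].
Qed.

Lemma estimation_error_le_mean_lyapunov (w1 w2 : R) k i j : adj i j ->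
  0 < w1 -> 0 < w2 ->
  Ex P (fun w => ((hs (hi k.+1 w)).2 i j - (hs (hi k w)).1 j) ^+ 2)
  <= mean_lyapunov w1 w2 k / w2.
Proof.
move=> aij w10 w20; rewrite ler_pdivlMr // mulrC -ExZ; last first.
  exact: integrable_estimation_error.
apply: le_Ex => [||w].
- by apply: integrable_rvZ; exact: integrable_estimation_error.
- exact: (intg k.+1 (hlyapunov w1 w2)).
rewrite /hlyapunov /lyapunov -[leLHS]add0r; apply: lerD.
  by apply: mulr_ge0; [exact: ltW | exact: disagreement_ge0].
apply: ler_wpM2l; first exact: ltW.
rewrite /estimation_error (bigD1 (i, j)) ?inE //= lerDl sumr_ge0 // => p _.
exact: sqr_ge0.
Qed.

End MeanSquare.

(** Estimates are matched on edges only: elsewhere [state] still thresholds a noise while [new_bits]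
    is false, but the control sums over neighbors alone. *)
Lemma state_hstate (R : realType) (n N : nat) (a : 'I_n -> R) (b : nat -> R)
    (adj : rel 'I_N) (c : 'I_N -> 'I_N -> R) (F : R -> R) (beta gamma M : R)
    (t0 : nat) (x0 : 'I_N -> 'cV[R]_n) (z0 : 'I_N -> 'I_N -> R)
    (dT : measure_display) (T : measurableType dT)
    (noise : 'I_N -> 'I_N -> nat -> T -> R) (w : T) (k : nat) : (0 < n)%N ->
  let K2 := K2mat n b in
  let st := state (Amat a) (Bvec R n) (K1mat a b) K2 adj c F beta gamma M t0
              x0 z0 noise w k in
  let y0 := fun i => rdot K2 (x0 i) in
  let hs := hstate adj c F beta gamma M t0 y0 z0
              (hist adj c F beta gamma M t0 y0 z0 noise k w) in
  (forall i, rdot K2 (st.1 i) = hs.1 i) /\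
  (forall i j, adj i j -> st.2 i j = hs.2 i j).
Proof.
move=> n0 K2 st y0 hs; rewrite {}/st {}/hs; elim: k => [//|k [IHy IHz]].
set st := state _ _ _ _ _ _ _ _ _ _ _ _ _ _ _ k in IHy IHz.
set h := hist _ _ _ _ _ _ _ _ _ _ k w in IHy IHz.
set hs := hstate _ _ _ _ _ _ _ _ _ h in IHy IHz.
have sh : size h = k by rewrite size_hist.
have zE i j : adj i j ->
  projM M (st.2 i j + beta / (t0 + 1 + k)%:R * (F (c i j - st.2 i j)
    - (if rdot K2 (st.1 j) + noise i j (t0 + 1 + k)%N w <= c i j then 1 else 0)))
  = next_z c F beta M (t0 + 1 + k)%:R hs.2 (fun i j =>
      (new_bits adj c F beta gamma M t0 y0 z0 noise h k w (i, j))%:R) i j.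
  move=> aij; rewrite /next_z IHz // IHy ffunE aij /=.
  by rewrite -/hs; case: (_ <= _).
split=> [i|i j aij]; rewrite /= -/h -/st sh; last exact: zE.
rewrite closed_loop_K2 // IHy /next_y; congr (_ + _ * _).
by apply: eq_bigr => j aij; rewrite zE // IHy.
Qed.

Theorem theorem1
  (R : realType) (n N : nat) (hn : (2 <= n)%N) (hN : (2 <= N)%N)
  (a : 'I_n -> R) (b : nat -> R)
  (adj : rel 'I_N)
  (adj_sym : forall i j, adj i j = adj j i)
  (adj_irr : forall i, ~~ adj i i)
  (adj_conn : forall i j, connect adj i j)
  (lam : seq R)
  (lam_eig : sorted <=%R lam /\
     char_poly (laplacian R adj) = \prod_(x <- lam) ('X - x%:P))
  (c : 'I_N -> 'I_N -> R) (sigma : R) (hsigma : 0 < sigma)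
  (beta gamma : R) (hbeta : 0 < beta) (hgamma : 0 < gamma)
  (t0 : nat) (ht0 : gamma * (dmax adj)%:R - 1 < t0%:R)
  (x0 : 'I_N -> 'cV[R]_n) (z0 : 'I_N -> 'I_N -> R) (M : R) (hM : 0 < M)
  (hx0 : forall i, `|rdot (K2mat n b) (x0 i)| <= M)
  (hz0 : forall i j, adj i j -> `|z0 i j| <= M)
  (dT : measure_display) (T : measurableType dT) (P : probability T R)
  (noise : 'I_N -> 'I_N -> nat -> T -> R)
  (noise_meas : forall i j t, adj i j -> measurable_fun setT (noise i j t))
  (noise_indep : mutually_independent P
      [set p : 'I_N * 'I_N * nat | adj p.1.1 p.1.2]
      (fun p => noise p.1.1 p.1.2 p.2))
  (noise_gauss : forall i j t, adj i j -> forall B : set R, measurable B ->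
      P (noise i j t @^-1` B) = normal_prob 0 sigma B) :
  let lambda2 := lam`_1 in
  let lambdaG := specnorm (Jmat R N *m Wmat R adj) ^+ 2 in
  let lambdaQW := specnorm (Qmat R adj *m Wmat R adj) ^+ 2 in
  let lambdaQL := specnorm (Qmat R adj *m laplacian R adj) ^+ 2 in
  let alpha := 2 * Num.sqrt lambdaQW + lambdaQL * lambda2 / lambdaG in
  let f_M := fM adj c sigma M in
  let K2 := K2mat n b in
  let st := fun k w => state (Amat a) (Bvec R n) (K1mat a b) K2 adj c
                         (Fnorm sigma) beta gamma M t0 x0 z0 noise w k in
  (* x_i(t0+1+k) and zhat_ij(t0+1+k) *)
  let x := fun k w i => (st k w).1 i in
  let zh := fun k w i j => (st k.+1 w).2 i j in
  let xbar := fun k w => (N%:R)^-1 *: \sum_(i < N) x k w i in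
  let err1 := fun i k => ('E_P[fun w => ((rdot K2 (x k w i) - rdot K2 (xbar k w)) ^+ 2)%R])%E in
  let err2 := fun i j k => ('E_P[fun w => ((zh k w i j - rdot K2 (x k w j)) ^+ 2)%R])%E in
  (beta > (2 * f_M)^-1 * (gamma * lambdaG ^+ 2 / lambda2 ^+ 3 + gamma * alpha) ->
     forall i j, adj i j ->
       err1 i @ \oo --> 0%E /\ err2 i j @ \oo --> 0%E)
  /\
  (gamma > lambda2^-1 ->
   beta > (2 * f_M)^-1 * (gamma ^+ 2 * lambdaG ^+ 2 / (lambda2 ^+ 2 * (gamma * lambda2 - 1))
                          + gamma * alpha + 1) ->
     exists C : R, 0 < C /\
       forall i j, adj i j -> forall k : nat,
         (err1 i k <= (C / (t0 + 1 + k)%:R)%:E)%E /\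
         (err2 i j k <= (C / (t0 + 1 + k)%:R)%:E)%E).
Proof.
case: lam_eig => lam_sorted lam_char.
move=> lambda2 lambdaG lambdaQW lambdaQL alpha f_M K2 st x zh xbar err1 err2.
have N0 : (0 < N)%N by apply: ltnW.
have n0 : (0 < n)%N by apply: ltnW.
have l20 : 0 < lambda2 := algebraic_connectivity_gt0 adj_sym adj_conn
  lam_sorted lam_char hN.
have gap := laplacian_spectral_gap adj_sym adj_conn lam_sorted lam_char.
have nG0 := specnorm_JW_gt0 R hN adj_conn.
have lG0 : 0 < lambdaG by rewrite exprn_gt0.
have f0 : 0 < f_M := fM_gt0 adj c M hsigma.
have F01 := Fnorm_itv01 sigma.
have Fmono i j (p q : R) : adj i j -> `|p| <= M -> `|q| <= M ->
    (p - q) * (Fnorm sigma (c i j - p) - Fnorm sigma (c i j - q))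
    <= - f_M * (p - q) ^+ 2.
  move=> aij pM qM.
  have cM (s : R) : `|s| <= M -> `|c i j - s| <= `|c i j| + M.
    by move=> sM; apply: le_trans (ler_normB _ _) _; rewrite lerD2l.
  have := Fnorm_strong_monotone hsigma (cM q qM) (cM p pM).
  have fm := fM_le c sigma M aij; rewrite -/f_M in fm.
  have := ler_wpM2r (sqr_ge0 (p - q)) fm.
  have -> : c i j - p - (c i j - q) = - (p - q) by ring.
  rewrite sqrrN !mulNr => h1 h2; rewrite -[leLHS]opprK lerN2.
  exact: le_trans h1 h2.
pose y0 i := rdot K2 (x0 i).
have init : bounded_state adj M y0 z0 by split.
have ncdf i j t s : adj i j ->
    fine (P (noise i j t @^-1` [set v | v <= s])) = Fnorm sigma s.
  by move=> aij; rewrite noise_gauss //; exact: half_line_measurable.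
pose hs := hstate adj c (Fnorm sigma) beta gamma M t0 y0 z0.
pose hi := hist adj c (Fnorm sigma) beta gamma M t0 y0 z0 noise.
have link k w := @state_hstate R n N a b adj c (Fnorm sigma) beta gamma M t0
  x0 z0 dT T noise w k n0.
have err1E i k : err1 i k
    = (Ex P (fun w => ((hs (hi k w)).1 i - mean (hs (hi k w)).1) ^+ 2))%:E.
  rewrite -expectation_Ex; last exact: integrable_disagreement.
  rewrite /err1; congr (expectation P _); apply/funext => w.
  rewrite /xbar rdot_mean; have [hy _] := link k w.
  rewrite /x /st hy; congr ((_ - mean _) ^+ 2).
  by apply/funext => l; rewrite hy.
have err2E i j k : adj i j -> err2 i j k
    = (Ex P (fun w => ((hs (hi k.+1 w)).2 i j - (hs (hi k w)).1 j) ^+ 2))%:E.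
  move=> aij; rewrite -expectation_Ex; last exact: integrable_estimation_error.
  rewrite /err2; congr (expectation P _); apply/funext => w.
  by rewrite /zh /x /st (link k w).1 (link k.+1 w).2.
pose ml := mean_lyapunov adj c (Fnorm sigma) beta gamma M t0 y0 z0 P noise.
have err1_le (w1 w2 : R) i k : 0 < w1 -> 0 < w2 ->
    (err1 i k <= (ml w1 w2 k / w1)%:E)%E.
  by move=> w10 w20; rewrite err1E lee_fin; apply: disagreement_le_mean_lyapunov.
have err2_le (w1 w2 : R) i j k : adj i j -> 0 < w1 -> 0 < w2 ->
    (err2 i j k <= (ml w1 w2 k / w2)%:E)%E.
  move=> aij w10 w20; rewrite err2E // lee_fin.
  exact: estimation_error_le_mean_lyapunov.
have err1_ge0 i k : (0 <= err1 i k)%E.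
  by apply: expectation_ge0 => w; exact: sqr_ge0.
have err2_ge0 i j k : (0 <= err2 i j k)%E.
  by apply: expectation_ge0 => w; exact: sqr_ge0.
pose r := gamma * lambdaG / lambda2.
have r0 : 0 < r by rewrite divr_gt0 ?mulr_gt0.
have sqrtQW : Num.sqrt lambdaQW = specnorm (Qmat R adj *m Wmat R adj).
  by rewrite sqrtr_sqr ger0_norm // specnorm_ge0.
have rec (w1 w2 mu : R) : 0 < w1 -> 0 < w2 ->
    w2 * r <= w1 * (gamma * lambda2 - mu) ->
    w1 * r <= w2 * (2 * beta * f_M - gamma * alpha - mu) ->
    exists2 C : R, 0 <= C & forall k, ml w1 w2 k.+1
      <= (1 - mu / (t0 + 1 + k).+1%:R) * ml w1 w2 k
         + C / (t0 + 1 + k).+1%:R ^+ 2.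
  by rewrite /alpha sqrtQW; apply: mean_lyapunov_recursion.
have mlB (w1 w2 : R) : 0 < w1 -> 0 < w2 ->
    exists B : R, forall k, 0 <= ml w1 w2 k <= B.
  by move=> w10 w20; apply: mean_lyapunov_bounded.
split.
- move=> hbeta1.
  (* The bound on [beta], multiplied by [2 * f_M] and then by [gamma * lambda2]. *)
  have hp : r ^+ 2 < (gamma * lambda2 - 0) * (2 * beta * f_M - gamma * alpha - 0).
    move: hbeta1; rewrite mulrC ltr_pdivrMr ?mulr_gt0 //.
    rewrite !subr0 -ltrBrDr -(ltr_pM2l (mulr_gt0 hgamma l20)).
    have -> : gamma * lambda2 * (gamma * lambdaG ^+ 2 / lambda2 ^+ 3) = r ^+ 2.
      by rewrite /r; field; rewrite gt_eqF.
    by rewrite [beta * _]mulrA [beta * 2]mulrC.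
  have p10 : 0 < gamma * lambda2 by rewrite mulr_gt0.
  have [w1 [w2 [mu [w10 w20 mu0 hw1 hw2]]]] := lyapunov_weights r0 p10 hp.
  have [C C0 hrec] := rec _ _ _ w10 w20 hw1 hw2.
  have [B hB] := mlB _ _ w10 w20.
  have ml0 : ml w1 w2 @ \oo --> (0 : R).
    apply: (@recursion_cvg0 _ _ (t0 + 1) mu C) => // k.
    by have /andP[] := hB k.
  have cvg_of (e : nat -> \bar R) (w : R) : (forall k, (0 <= e k)%E) ->
      (forall k, (e k <= (ml w1 w2 k / w)%:E)%E) -> e @ \oo --> 0%E.
    move=> e0 ew; apply: (@squeeze_cvge _ _ _ _ (cst 0%E) _
      (fun k => (ml w1 w2 k / w)%:E)).
    + by apply: nearW => k; rewrite e0 ew.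
    + exact: cvg_cst.
    + apply: cvg_EFin; first exact: nearW.
      rewrite -[X in _ --> X](mul0r w^-1).
      by apply: cvgM => //; exact: cvg_cst.
  move=> i j aij; split.
    by apply: (cvg_of _ w1) => // k; exact: err1_le.
  by apply: (cvg_of _ w2) => // k; exact: err2_le.
move=> hgamma1 hbeta1.
have gl1 : 1 < gamma * lambda2.
  by rewrite -ltr_pdivrMr // mul1r.
(* Same computation with the multiplier [gamma * lambda2 - 1], positive by the condition on
   [gamma]. *)
have hp : r ^+ 2 < (gamma * lambda2 - 1) * (2 * beta * f_M - gamma * alpha - 1).
  have gl0 : 0 < gamma * lambda2 - 1 by rewrite subr_gt0.
  move: hbeta1; rewrite mulrC ltr_pdivrMr ?mulr_gt0 //.
  rewrite -ltrBrDr -ltrBrDr -(ltr_pM2l gl0).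
  have -> : (gamma * lambda2 - 1) *
      (gamma ^+ 2 * lambdaG ^+ 2 / (lambda2 ^+ 2 * (gamma * lambda2 - 1)))
      = r ^+ 2.
    by rewrite /r; field; rewrite !gt_eqF.
  by rewrite [beta * _]mulrA [beta * 2]mulrC [_ - 1 - _]addrAC.
have [w1 [w2 [mu [w10 w20 mu1 hw1 hw2]]]] := lyapunov_weights r0 gl1 hp.
have [C C0 hrec] := rec _ _ _ w10 w20 hw1 hw2.
have [B hB] := mlB _ _ w10 w20.
have [C' [C'0 hC']] : exists C' : R, 0 < C' /\
    forall k, ml w1 w2 k <= C' / (t0 + k).+1%:R.
  apply: (@recursion_bound _ _ t0 mu C B) => // k.
  by have := hrec k; rewrite addn1 addSn.
(* Each error is the Lyapunov bound divided by its own weight; the sum dominates both. *)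
exists (C' / w1 + C' / w2); split; first by rewrite addr_gt0 ?divr_gt0.
move=> i j aij k; have hk := hC' k; rewrite addn1 addSn.
set t : R := (t0 + k).+1%:R in hk *; have t00 : 0 < t by rewrite ltr0Sn.
have bnd w : 0 < w -> C' / w <= C' / w1 + C' / w2 ->
    ml w1 w2 k / w <= (C' / w1 + C' / w2) / t.
  move=> w0 hw; apply: (@le_trans _ _ (C' / t / w)).
    by rewrite ler_pM2r ?invr_gt0.
  by rewrite mulrAC ler_pM2r ?invr_gt0.
split.
  apply: le_trans (err1_le w1 w2 i k w10 w20) _; rewrite lee_fin.
  by apply: bnd => //; rewrite lerDl divr_ge0 // ltW.
apply: le_trans (err2_le w1 w2 i j k aij w10 w20) _; rewrite lee_fin.
by apply: bnd => //; rewrite lerDr divr_ge0 // ltW.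
Qed.
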